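(* Let $n\ge 2$ and $d\ge 1$ be integers and put $m_{d,n}=(d-1)^{n-1}+(d-1)^{n-2}+\dots+(d-1)+1$. Then there exists a generic real symmetric $n^d$-tensor all of whose $m_{d,n}$ eigenpoints (in $\mathbb{C}P^{n-1}$) are real, i.e. lie in $\mathbb{R}P^{n-1}$. Equivalently, there exists a real homogeneous polynomial of degree $d$ in $n$ variables whose restriction to the unit sphere $S^{n-1}\subset\mathbb{R}^n$ has the maximum possible finite number of critical points, which is equal to $2m_{d,n}$. Moreover, such a symmetric tensor exists among traceless tensors (respectively, such a homogeneous polynomial exists among harmonic polynomials).
   Context: An $n^d$-tensor is an array $A=(a_{i_1\dots i_d})_{1\le i_1,\dots,i_d\le n}$; it is real if all $a_{i_1\dots i_d}\in\mathbb{R}$, and symmetric if $a_{i_{\sigma_1}\dots i_{\sigma_d}}=a_{i_1\dots i_d}$ for every permutation $\sigma\in S_d$. For $x\in\mathbb{C}^n$ let $Ax^{d-1}\in\mathbb{C}^n$ be the vector whose $i$-th coordinate is $\sum_{i_2,\dots,i_d=1}^n a_{i i_2\dots i_d}x_{i_2}\cdots x_{i_d}$. A non-zero $x\in\mathbb{C}^n$ is an eigenvector of $A$ if $Ax^{d-1}=\lambda x$ for some $\lambda\in\mathbb{C}$; the point $[x]\in\mathbb{C}P^{n-1}$ defined by an eigenvector $x$ is called an eigenpoint of $A$. Note that $m_{d,n}=\frac{(d-1)^n-1}{d-2}$ for $d\neq 2$, and $m_{2,n}=n$. A symmetric $n^d$-tensor is called generic if it lies outside the eigendiscriminant, the algebraic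 hypersurface of those symmetric tensors whose number of eigenpoints is not equal to the expected number $m_{d,n}$; thus a generic symmetric tensor has exactly $m_{d,n}$ distinct eigenpoints in $\mathbb{C}P^{n-1}$. Real symmetric $n^d$-tensors $A$ correspond bijectively to real homogeneous polynomials of degree $d$ in $n$ variables via $f_A(x)=\sum_{i_1,\dots,i_d=1}^n a_{i_1\dots i_d}x_{i_1}\cdots x_{i_d}$; the critical points of $f_A|_{S^{n-1}}$ are exactly the unit real eigenvectors of $A$. A symmetric tensor $A$ is traceless if $\sum_{i=1}^n a_{i i i_3\dots i_d}=0$ for all $i_3,\dots,i_d\in\{1,\dots,n\}$ (no condition if $d=1$); equivalently $f_A$ is harmonic, i.e. $\frac{\partial^2 f_A}{\partial x_1^2}+\dots+\frac{\partial^2 f_A}{\partial x_n^2}=0$. The maximality of $2m_{d,n}$ refers to the following bound: if $f$ is a real homogeneous polynomial of degree $d$ in $n$ variables and $f|_{S^{n-1}}$ is a Morse function (all its critical points are non-degenerate), then $f|_{S^{n-1}}$ has at most $2m_{d,n}$ critical points. *)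

(* Defs.v *)
From HB Require Import structures.
From mathcomp Require Import all_boot all_order all_fingroup all_algebra.
From mathcomp Require Import reals complex mpoly.

Set Implicit Arguments.
Unset Strict Implicit.
Unset Printing Implicit Defensive.

Import GRing.Theory.
Local Open Scope ring_scope.

Definition number_of (T : eqType) (P : T -> Prop) (N : nat) : Prop :=
  exists s : seq T, [/\ uniq s, size s = N & forall x, x \in s <-> P x].

(* 0 ^ 0 = 1 in nat, so expected_number 1 n = 1 when n > 0. *)
Definition expected_number (d n : nat) : nat := (\sum_(i < n) d.-1 ^ i)%N.

Definition tensor (F : fieldType) (n d : nat) := {ffun d.-tuple 'I_n -> F}.

(* The entry of A at a list of indices; the junk value 0 is only reached when
   the length of the list is not d. *)
Definition entry (F : fieldType) (n d : nat) (A : tensor F n d)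
    (s : seq 'I_n) : F :=
  if insub s is Some t then A t else 0.

Definition tensor_symmetric (F : fieldType) (n d : nat) (A : tensor F n d) :
    Prop :=
  forall (s : 'S_d) (t : d.-tuple 'I_n),
    A [tuple tnth t (s k) | k < d] = A t.

(* The condition is only meaningful for size u = d - 2; for all other u (in
   particular for every u when d = 1) it reads 0 = 0. *)
Definition traceless (F : fieldType) (n d : nat) (A : tensor F n d) : Prop :=
  forall u : seq 'I_n, \sum_(i < n) entry A [:: i, i & u] = 0.

(* A x^(d-1) *)
Definition tensor_apply (F : fieldType) (n d : nat) (A : tensor F n d)
    (x : 'rV[F]_n) : 'rV[F]_n :=
  \row_(i < n) \sum_(t : d.-1.-tuple 'I_n)
     entry A (i :: t) * \prod_(j <- t) x 0 j.

Definition eigenvector (F : fieldType) (n d : nat) (A : tensor F n d)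
    (x : 'rV[F]_n) : Prop :=
  x != 0 /\ exists lambda : F, tensor_apply A x = lambda *: x.

(* The point [x] of projective space is the line <[x]> in F^n, so that equality
   of points is equality of subspaces. *)
Definition eigenpoint (F : fieldType) (n d : nat) (A : tensor F n d)
    (p : {vspace 'rV[F]_n}) : Prop :=
  exists2 x : 'rV[F]_n, eigenvector A x & p = <[x]>%VS.

Definition complexify (R : realType) (n d : nat) (A : tensor R n d) :
    tensor R[i] n d :=
  [ffun t => real_complex R (A t)].

(* The points of the complex projective space that lie in the real one. *)
Definition real_point (R : realType) (n : nat) (p : {vspace 'rV[R[i]]_n}) :
    Prop :=
  exists2 y : 'rV[R]_n, y != 0 & p = <[map_mx (real_complex R) y]>%VS.

(* A symmetric tensor outside the eigendiscriminant, i.e. whose number of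
   complex eigenpoints is finite and equal to the expected one. *)
Definition generic_symmetric (R : realType) (n d : nat) (A : tensor R n d) :
    Prop :=
  tensor_symmetric A /\
  number_of (eigenpoint (complexify A)) (expected_number d n).

Definition harmonic (R : realType) (n : nat) (f : {mpoly R[n]}) : Prop :=
  \sum_(i < n) f^`M(i)^`M(i) = 0.

Definition dot (R : realType) (n : nat) (u v : 'rV[R]_n) : R :=
  \sum_(i < n) u 0 i * v 0 i.

(* The differential of f at x vanishes on the tangent space of the unit sphere
   at x, which is the orthogonal complement of x. *)
Definition sphere_critical (R : realType) (n : nat) (f : {mpoly R[n]})
    (x : 'rV[R]_n) : Prop :=
  dot x x = 1 /\
  forall v : 'rV[R]_n, dot x v = 0 -> \sum_(i < n) (f^`M(i)).@[x 0] * v 0 i = 0.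

(* The i-th coordinate of y |-> grad f(y) - <y, grad f(y)> y, which on the unit
   sphere is the gradient of the restriction of f to the sphere. *)
Definition sphere_grad (R : realType) (n : nat) (f : {mpoly R[n]})
    (i : 'I_n) : {mpoly R[n]} :=
  f^`M(i) - (\sum_(j < n) 'X_j * f^`M(j)) * 'X_i.

(* <D_v G, w> for G the gradient of the restriction of f to the sphere; for v, w
   tangent at x this is the Riemannian Hessian of the restriction, since the
   covariant derivative on the sphere is the tangential part of D_v. At a
   critical point it is the Hessian in any chart. *)
Definition sphere_hessian (R : realType) (n : nat) (f : {mpoly R[n]})
    (x v w : 'rV[R]_n) : R :=
  \sum_(i < n) \sum_(j < n) ((sphere_grad f i)^`M(j)).@[x 0] * v 0 j * w 0 i.

Definition sphere_morse (R : realType) (n : nat) (f : {mpoly R[n]}) : Prop :=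
  forall x : 'rV[R]_n, sphere_critical f x ->
  forall v : 'rV[R]_n, dot x v = 0 ->
    (forall w : 'rV[R]_n, dot x w = 0 -> sphere_hessian f x v w = 0) -> v = 0.

(* Main.v *)
(* Maximal configurations are built by induction on the number of variables.
   Let h be a harmonic form of degree d in x, all of whose m eigenpoints are
   real, and let Z(x, t) be the zonal harmonic of degree d with axis t.  For
   f = Z + e h, the x-part of the eigenvector equation of f says that x = 0 or
   that x is an eigenvector of h; so the eigenpoints of f are the pole (0 : 1)
   and the points (u : t) with u one of the m unit eigenvectors of h and t a
   root of a univariate polynomial of degree d - 1.  At e = 0 this polynomial
   is, up to a factor, again a zonal function; its roots are real and simple,
   and remain so for small e.  This gives 1 + (d - 1) m real eigenpoints, which
   are all the complex ones and are all non-degenerate.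

   For the upper bound, N non-degenerate eigenpoints x of g with l(x) = 1 for a
   linear form l yield N (d - 2) + 1 non-degenerate zeros (x : t) of the n forms
   e d_i g - x_i prod_(k < d - 2) (t - k l(x)) of degree d - 1 in n + 1
   variables, the extra one being (0 : 1).  A Bezout inequality for
   non-degenerate zeros bounds their number by (d - 1)^n.  It is proved by
   counting dimensions: if h0, h1 are linear forms separating the M zeros of
   F_1, ..., F_n, then the products of the F_i, h0 and h1 with exponent of h1
   less than M are linearly independent, as their lowest order terms at the
   zeros show. *)
Require Import Defs.
From HB Require Import structures.
From mathcomp Require Import all_boot all_order all_fingroup all_algebra.
From mathcomp Require Import reals polyrcf complex mpoly.
From mathcomp Require Import ring lra zify.

Set Implicit Arguments.
Unset Strict Implicit.
Unset Printing Implicit Defensive.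

Import Order.TTheory GRing.Theory Num.Theory.
Local Open Scope ring_scope.

(** * Derivatives of multivariate polynomials *)

(** The bound comes out exact because [(d - 2) m + 1 = (d - 1) ^ n] for the expected number [m] in n
    variables. The eigenvector equation contains an unknown factor, the eigenvalue; a form of degree
    [d - 2] in [(x : t)] takes its place. Distinct linear factors and a small [e] make the lifts of
    a real eigenpoint real and simple, so that the Bezout inequality is needed for real zeros only.
    Its dimension count loses a constant [M - 1] in the degree, which disappears as the degree
    grows. Degrees 1 and 2, where [d - 2] is not positive, are bounded directly. In the construction
    the zonal polynomials form an Appell sequence (the derivative lowers the index), which turns
    harmonicity into a three-term recurrence. The recurrence gives simplicity of the roots by
    descent, and their reality by following a quotient of consecutive terms in a complex half-plane.
    Non-degeneracy is stated independently of the length of a vector, since the points [(u, t)] are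
    not unit vectors. *)

Section MpolyCalculus.
Variables (n : nat) (R : fieldType) (S : comNzRingType) (phi : {rmorphism R -> S}).
Implicit Types (f : {mpoly R[n]}).

Lemma mderiv_mwiden f (i : 'I_n) :
  (mwiden f)^`M(widen_ord (leqnSn n) i) = mwiden f^`M(i).
Proof.
elim/mpolyind: f => [|c m p _ _ IH]; first by rewrite mwiden0 !mderiv0 mwiden0.
rewrite mwidenD !mderivD mwidenD IH; congr (_ + _).
rewrite mwidenZ !mderivZ mwidenZ mwidenX !mderivX mwidenZ mwidenX; congr (_ *: _).
rewrite mnmwiden_widen; congr (_ *: 'X_[_]).
apply/mnmP => j; rewrite mnmBE mnm1E.
have [k ->|->] := unliftP ord_max j; last first.
  by rewrite !mnmwiden_ordmax.
have -> : lift ord_max k = widen_ord (leqnSn n) k.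
  by apply/val_inj; rewrite /= /bump leqNgt ltn_ord.
by rewrite !mnmwiden_widen mnmBE mnm1E.
Qed.

Lemma mderiv_mwiden_max f : (mwiden f)^`M(ord_max) = 0.
Proof.
elim/mpolyind: f => [|c m p _ _ IH]; first by rewrite mwiden0 mderiv0.
rewrite mwidenD mderivD IH mwidenZ mderivZ mwidenX mderivX mnmwiden_ordmax.
by rewrite scale0r scaler0 addr0.
Qed.

Lemma mmap_mwiden f (z : 'I_n.+1 -> S) :
  mmap phi z (mwiden f) = mmap phi (fun i => z (widen_ord (leqnSn n) i)) f.
Proof.
elim/mpolyind: f => [|c m p _ _ IH]; first by rewrite mwiden0 !mmap0.
rewrite mwidenD !mmapD IH; congr (_ + _).
rewrite mwidenZ !mmapZ mwidenX !mmapX /mmap1 big_ord_recr /= mnmwiden_ordmax.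
by rewrite expr0 mulr1; congr (_ * _); apply: eq_bigr => i _; rewrite mnmwiden_widen.
Qed.

Lemma dhomog_mwiden f d : f \is d.-homog -> mwiden f \is d.-homog.
Proof.
move=> hf; rewrite (mpolyE f) raddf_sum /=.
rewrite big_seq; apply: rpred_sum => m hm; rewrite mwidenZ mwidenX; apply: rpredZ.
rewrite dhomogX -(dhomog_mf hf hm) /=; apply/eqP.
rewrite !mdegE big_ord_recr /= mnmwiden_ordmax addn0.
by apply: eq_bigr => i _; rewrite mnmwiden_widen.
Qed.

Lemma dhomog_mderiv f d i : f \is d.+1.-homog -> f^`M(i) \is d.-homog.
Proof.
move=> hf; rewrite (mpolyE f) raddf_sum /= big_seq; apply: rpred_sum => m hm.
rewrite mderivZ mderivX; apply: rpredZ.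
have [-> |mi] := eqVneq (m i) 0%N; first by rewrite scale0r rpred0.
apply: rpredZ; rewrite dhomogX.
have : mdeg m = d.+1 by apply: (dhomog_mf hf hm).
rewrite -{1}(@submK _ U_(i)%MM m); last by rewrite lep1mP.
by rewrite mdegD mdeg1 addn1 => -[<-] /=.
Qed.

Lemma mderiv_homog0 f i : f \is 0.-homog -> f^`M(i) = 0.
Proof.
move=> hf; rewrite (mpolyE f) raddf_sum /= big_seq big1 // => m hm.
rewrite mderivZ mderivX.
have /eqP : mdeg m = 0%N by apply: (dhomog_mf hf hm).
by rewrite mdeg_eq0 => /eqP ->; rewrite mnm0E scale0r scaler0.
Qed.

Lemma mpoly_euler f d : f \is d.-homog -> \sum_i 'X_i * f^`M(i) = f *+ d.
Proof.
move=> hf; rewrite [in RHS](mpolyE f) -sumrMnl [RHS]big_seq.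
have E i : 'X_i * f^`M(i) =
    \sum_(m <- msupp f | m \in msupp f) 'X_i * (f@_m *: 'X_[m])^`M(i).
  by rewrite -big_seq -mulr_sumr -raddf_sum /= -mpolyE.
rewrite (eq_bigr _ (fun i _ => E i)).
rewrite exchange_big /=; apply: eq_bigr => m hm.
rewrite -(dhomog_mf hf hm) /= mdegE -sumrMnr; apply: eq_bigr => i _.
rewrite mderivZ mderivX.
have [-> |mi] := eqVneq (m i) 0%N; first by rewrite scale0r scaler0 mulr0 mulr0n.
have XE : 'X_i * 'X_[m - U_(i)] = 'X_[m] :> {mpoly R[n]}.
  by rewrite -mpolyXD addmC submK // lep1mP.
by rewrite -!scalerAr XE scaler_nat scalerMnr.
Qed.

Lemma mmap_homog f d c (z : 'I_n -> S) : f \is d.-homog ->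
  mmap phi (fun i => c * z i) f = c ^+ d * mmap phi z f.
Proof.
move=> hf; rewrite /mmap mulr_sumr big_seq [RHS]big_seq.
apply: eq_bigr => m hm; rewrite mulrCA; congr (_ * _).
rewrite -(dhomog_mf hf hm) /= /mmap1 mdegE expr_sum -big_split.
by apply: eq_bigr => i _; rewrite exprMn.
Qed.

Lemma mmap_ext (g h : 'I_n -> S) f :
  g =1 h -> mmap phi g f = mmap phi h f.
Proof. by move=> gh; apply: eq_bigr => m _; rewrite (mmap1_eq _ gh). Qed.

End MpolyCalculus.

(** * Perturbation of simple real roots *)

Definition simply_split (R : fieldType) (p : {poly R}) (s : seq R) : Prop :=
  uniq s /\ exists2 c : R, c != 0 & p = c *: \prod_(x <- s) ('X - x%:P).

Definition eventually_small (R : numDomainType) (P : R -> Prop) : Prop :=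
  exists2 e0 : R, 0 < e0 & forall e, 0 < e < e0 -> P e.

Section Small.
Variable R : realFieldType.

Lemma eventually_smallT (P : R -> Prop) :
  (forall e, 0 < e -> P e) -> eventually_small P.
Proof. by move=> H; exists 1; rewrite ?ltr01 // => e /andP[e0 _]; apply: H. Qed.

Lemma eventually_small_and (P Q : R -> Prop) :
  eventually_small P -> eventually_small Q ->
  eventually_small (fun e => P e /\ Q e).
Proof.
move=> [a a0 HP] [b b0 HQ]; exists (Num.min a b); first by rewrite lt_min a0.
by move=> e; rewrite lt_min => /and3P[e0 ea eb]; split; [apply: HP|apply: HQ];
  rewrite e0.
Qed.

Lemma eventually_small_all (T : eqType) (s : seq T) (P : T -> R -> Prop) :
  {in s, forall x, eventually_small (P x)} ->
  eventually_small (fun e => {in s, forall x, P x e}).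
Proof.
elim: s => [|x s IH] H; first by apply: eventually_smallT.
have [|a a0 Ha] := IH; first by move=> y ys; apply: H; rewrite inE ys orbT.
have [b b0 Hb] := eventually_small_and (H x (mem_head _ _)) (ex_intro2 _ _ a a0 Ha).
exists b => // e /Hb [Px Ps] y; rewrite inE => /orP[/eqP ->//|]; exact: Ps.
Qed.

Lemma eventually_small_ex (P : R -> Prop) :
  eventually_small P -> exists2 e : R, 0 < e & P e.
Proof.
move=> [a a0 H]; exists (a / 2); first by rewrite divr_gt0.
by apply: H; lra.
Qed.

Lemma eventually_small_lt (c : R) : 0 < c -> eventually_small (fun e => e < c).
Proof. by move=> c0; exists c => // e /andP[]. Qed.

Lemma eventually_small_mulr_lt (a c : R) :
  0 < c -> eventually_small (fun e => `|e * a| < c).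
Proof.
move=> c0; exists (c / (`|a| + 1)); first by rewrite divr_gt0 // ltr_wpDl.
move=> e /andP[e0]; rewrite ltr_pdivlMr ?ltr_wpDl // => H.
rewrite normrM (gtr0_norm e0); have := normr_ge0 a; nra.
Qed.

(** The product is [a * b] plus a linear and a quadratic term in [e]; each is kept below half of
    [- (a * b)], the quadratic one with the help of [e < 1]. *)
Lemma eventually_small_opp_sign (a b a' b' : R) : a * b < 0 ->
  eventually_small (fun e => (a + e * a') * (b + e * b') < 0).
Proof.
move=> ab.
have [e1 e10 H1] := @eventually_small_mulr_lt (a * b' + a' * b) (- (a * b) / 2)
  ltac:(by lra).
have [e2 e20 H2] := @eventually_small_mulr_lt (a' * b') (- (a * b) / 2)
  ltac:(by lra).
have [e0 e00 H] := eventually_small_and (ex_intro2 _ _ e1 e10 H1)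
  (eventually_small_and (ex_intro2 _ _ e2 e20 H2) (eventually_small_lt ltr01)).
exists e0 => // e he; have [K1 [K2 K3]] := H _ he.
move: K1 K2; rewrite !ltr_norml => /andP[_ K1] /andP[_ K2].
have : e * (e * (a' * b')) < - (a * b) / 2.
  case/andP: he => ? _; have [?|?] := lerP (a' * b') 0; nra.
lra.
Qed.

End Small.

Section Perturbation.
Variable R : rcfType.
Implicit Types (p q : {poly R}) (s : seq R).

Lemma size_simply_split p s : simply_split p s -> size p = (size s).+1.
Proof. by move=> [_ [c c0 ->]]; rewrite size_scale // size_prod_XsubC. Qed.

Lemma simply_split_mem p s x : simply_split p s -> root p x = (x \in s).
Proof. by move=> [_ [c c0 ->]]; rewrite rootZ // root_prod_XsubC. Qed.

Lemma simply_split_deriv p s x : simply_split p s -> x \in s -> p^`().[x] != 0.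
Proof.
move=> [us [c c0 ->]] xs; rewrite (big_rem x xs) /= derivZ derivM hornerZ mulf_neq0 //.
rewrite hornerD !hornerM derivXsubC !hornerE subrr mul0r addr0.
rewrite -rootE root_prod_XsubC.
by rewrite mem_rem_uniq // inE eqxx.
Qed.

(** For [d] below the distance to the other roots [y], the product is [c ^ 2 * (- d ^ 2)] times the
    positive numbers [(x - y) ^ 2 - d ^ 2]. *)
Lemma simply_split_opp_sign p s : simply_split p s ->
  eventually_small (fun d => {in s, forall x, p.[x - d] * p.[x + d] < 0}).
Proof.
move=> [us [c c0 ->]]; apply: eventually_small_all => x xs.
have [|d0 d00 H] := @eventually_small_all R R (rem x s) (fun y d => d < `|x - y|).
  move=> y; rewrite mem_rem_uniq // inE => /andP[yx _]; apply: eventually_small_lt.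
  by rewrite normr_gt0 subr_eq0 eq_sym.
exists d0 => // d hd; have {}H := H d hd.
case/andP: hd => d1 _.
rewrite !hornerZ !horner_prod mulrACA -expr2 -big_split /=.
rewrite pmulr_rlt0 ?exprn_even_gt0 // (big_rem x xs) /= !hornerE.
rewrite nmulr_rlt0; last by nra.
rewrite big_seq; apply: prodr_gt0 => y ys; rewrite !hornerE.
by have := H y ys; rewrite lter_normr; case/orP => ?; nra.
Qed.

Lemma simply_split_gap p s : simply_split p s ->
  eventually_small (fun d => {in s &, forall x y, `|x - y| < d + d -> x = y}).
Proof.
move=> [us _].
have : eventually_small (fun d : R => {in s, forall x, {in s, forall y,
    `|x - y| < d + d -> x = y}}).
  apply: eventually_small_all => x _; apply: eventually_small_all => y _.
  have [->|xy] := eqVneq x y; first by apply: eventually_smallT.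
  exists (`|x - y| / 2); first by rewrite divr_gt0 // normr_gt0 subr_eq0.
  by move=> e he h; exfalso; lra.
by move=> [d0 d00 H]; exists d0 => // d /H {}H x y xs ys; apply: H.
Qed.

(** The sign changes around the roots survive a small perturbation, so each of the disjoint
    intervals still contains a root; as [q] does not raise the degree, these roots are all of
    them. *)
Lemma simply_split_perturb p q s : simply_split p s -> (1 < size p)%N ->
  (size q <= size p)%N ->
  eventually_small (fun e => exists2 s',
    size s' = size s & simply_split (p + e *: q) s').
Proof.
move=> hp hs hq.
have [d d0 [Hsgn Hgap]] := eventually_small_ex
  (eventually_small_and (simply_split_opp_sign hp) (simply_split_gap hp)).
have [|e0 e00 He] := @eventually_small_all R R s
   (fun x e => (p + e *: q).[x - d] * (p + e *: q).[x + d] < 0).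
  move=> x xs.
  have [e1 e10 H] := eventually_small_opp_sign q.[x - d] q.[x + d] (Hsgn x xs).
  by exists e1 => // e he; rewrite !hornerD !hornerZ; apply: H.
exists e0 => // e /He {}He.
have rt x : {y | x \in s -> (y \in `]x - d, x + d[) && root (p + e *: q) y}.
  case: (boolP (x \in s)) => xs; last by exists 0.
  have [||y H1 H2] := @poly_ivtoo _ (p + e *: q) (x - d) (x + d).
  - by lra.
  - exact: He.
  by exists y; rewrite H1.
pose g x := sval (rt x).
have gP x : x \in s -> (x - d < g x < x + d) && root (p + e *: q) (g x).
  by rewrite /g; case: (rt x) => y /= H /H; rewrite in_itv.
have us' : uniq (map g s).
  rewrite map_inj_in_uniq; first by case: hp.
  move=> x y /[dup] xs /gP /andP[hx _] /[dup] ys /gP /andP[hy _] E.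
  by apply: Hgap => //; rewrite -E in hy; rewrite ltr_norml; lra.
exists (map g s); first by rewrite size_map.
have sz : size s = (size p).-1 by rewrite (size_simply_split hp).
have nz : p + e *: q != 0.
  apply/eqP => E; case: s {hp rt g gP us' Hsgn Hgap} He sz => [_|x s He _].
    by move=> /= /eqP; rewrite -subn1 eq_sym subn_eq0 leqNgt hs.
  by have := He x (mem_head _ _); rewrite E !horner0 mul0r ltxx.
have al : all (root (p + e *: q)) (map g s).
  by apply/allP => _ /mapP[x xs ->]; case/andP: (gP x xs).
have szpq : size (p + e *: q) = (size (map g s)).+1.
  apply/eqP; rewrite eqn_leq (max_poly_roots nz al us') andbT size_map sz.
  rewrite prednK; last by apply: ltn_trans hs.
  rewrite (leq_trans (size_polyD _ _)) // geq_max leqnn /=.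
  exact: leq_trans (size_scale_leq _ _) hq.
split=> //; exists (lead_coef (p + e *: q)); first by rewrite lead_coef_eq0.
by apply: all_roots_prod_XsubC => //; rewrite uniq_rootsE.
Qed.

End Perturbation.

(** * Zonal harmonics in one variable *)

Section RealRooted.
Variable R : rcfType.
Local Notation toC := (real_complex R).

(** The factorization over [R[i]] descends because each root equals its real part; a repeated root
    would be a root of the derivative. *)
Lemma simply_split_real (p : {poly R}) : p != 0 ->
  (forall z : R[i], root (map_poly toC p) z -> complex.Im z = 0) ->
  (forall x, root p x -> p^`().[x] != 0) ->
  exists s, simply_split p s.
Proof.
move=> p0 Hre Hsimple.
have [r Er] := closed_field_poly_normal (map_poly toC p).
have rR z : z \in r -> toC (complex.Re z) = z.
  move=> zr; have /Hre : root (map_poly toC p) z.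
    by rewrite Er rootZ ?root_prod_XsubC // lead_coef_eq0 map_poly_eq0.
  by case: z {zr} => a b /= ->.
pose s := map (@complex.Re R) r.
have Ep : p = lead_coef p *: \prod_(x <- s) ('X - x%:P).
  apply: (map_poly_inj toC); rewrite map_polyZ rmorph_prod /= Er.
  rewrite lead_coef_map; congr (_ *: _); rewrite big_map big_seq [RHS]big_seq.
  by apply: eq_bigr => z zr; rewrite map_polyXsubC /= rR.
have c0 : lead_coef p != 0 by rewrite lead_coef_eq0.
exists s; split; last by exists (lead_coef p).
apply: count_mem_uniq => x; case: (boolP (x \in s)) => xs; last by apply/count_memPn.
rewrite (seq.permP (perm_to_rem xs)) /= eqxx; suff /count_memPn -> : x \notin rem x s by [].
apply/negP => xr; have /Hsimple/eqP : root p x.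
  by rewrite Ep rootZ // root_prod_XsubC.
apply; rewrite Ep (big_rem x xs) (big_rem x xr) /= derivZ !derivM derivXsubC.
by rewrite !hornerE subrr; ring.
Qed.

End RealRooted.

Section Zonal.
Variables (R : rcfType) (n : nat).
Hypothesis n_gt0 : (0 < n)%N.
Local Notation toC := (real_complex R).

(** The denominator [2 k (2 (k - 1) + n)] is the factor that the Laplacian in n variables puts in
    front of [|x| ^ (2 k - 2)] when applied to [|x| ^ (2 k)]. The dependence on [d] is left to the
    falling factorial in [zonal_coef]; this is why differentiating [zonal] only lowers its index. *)
Fixpoint zonal_ratio k : R :=
  if k is k'.+1 then - zonal_ratio k' / ((k.*2) * (k'.*2 + n))%:R else 1.

Definition zonal_coef d k : R := (d ^_ k.*2)%:R * zonal_ratio k.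

Lemma zonal_coefS d k :
  zonal_coef d k.+1 * ((k.+1.*2) * (k.*2 + n))%:R =
  - (zonal_coef d k * ((d - k.*2) * (d - k.*2).-1)%:R).
Proof.
rewrite /zonal_coef [zonal_ratio _]/=.
have : ((k.+1.*2) * (k.*2 + n))%:R != 0 :> R by rewrite pnatr_eq0; lia.
move: (_ * _)%:R => c c0; rewrite doubleS !ffactnSr -subn1 -subnDA addn1 !natrM.
by field.
Qed.

Lemma zonal_coef_small d k : (d < k.*2)%N -> zonal_coef d k = 0.
Proof. by move=> dk; rewrite /zonal_coef ffact_small // mul0r. Qed.

Lemma deriv_sumE (I : Type) (r : seq I) (P : pred I) (F : I -> {poly R}) :
  (\sum_(i <- r | P i) F i)^`() = \sum_(i <- r | P i) (F i)^`().
Proof. exact: raddf_sum. Qed.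

(* [zonal d] is the restriction to |x| = 1 of the harmonic form of degree d in
   (x, t), with x of dimension n, that depends on |x| and t only; [radial d] is
   the common factor of its derivatives in x, so that the gradient along x is
   [radial d] times x. *)
Definition zonal d : {poly R} := \sum_(k < d.+1) zonal_coef d k *: 'X^(d - k.*2).

Definition radial d : {poly R} :=
  \sum_(k < d.+1) (k.*2%:R * zonal_coef d k) *: 'X^(d - k.*2).

(** For harmonicity: [A] collects the terms of the Laplacian in x, [B] those of the second
    derivative in t, which cancel after a shift of the index. *)
Lemma sum_shift_eq0 (V : zmodType) (A B : nat -> V) N : A 0%N = 0 -> B N = 0 ->
  (forall k, A k.+1 + B k = 0) -> \sum_(k < N.+1) (A k + B k) = 0.
Proof.
move=> A0 BN H; rewrite big_split /= big_ord_recl [X in _ + X]big_ord_recr /=.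
by rewrite A0 BN add0r addr0 -big_split /= big1.
Qed.

Lemma deriv_zonal d : (zonal d.+1)^`() = d.+1%:R *: zonal d.
Proof.
rewrite /zonal deriv_sumE big_ord_recr /= zonal_coef_small; last by lia.
rewrite scale0r deriv0 addr0 scaler_sumr; apply: eq_bigr => k _.
rewrite derivZ derivXn -scaler_nat !scalerA; congr (_ *: 'X^_); last by lia.
rewrite /zonal_coef mulrAC -natrM -ffactnSr ffactnS natrM.
by rewrite -?addnn ?addnS -!natr1 ?natrD; ring.
Qed.

(** Euler's identity for the zonal form on [|x| = 1]: the derivatives in x contribute
    [x . (radial d * x) = radial d]. *)
Lemma radialE d : radial d = d%:R *: zonal d - 'X * (zonal d)^`().
Proof.
rewrite /radial /zonal deriv_sumE scaler_sumr mulr_sumr -sumrB.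
apply: eq_bigr => k _; rewrite derivZ derivXn -scaler_nat.
have [dk|dk] := ltnP d k.*2.
  by rewrite zonal_coef_small // mulr0 !scale0r scaler0 mulr0 subr0.
rewrite -!scalerAr; have [E|dk0] := posnP (d - k.*2).
  by rewrite E scale0r !scaler0 subr0 scalerA (_ : k.*2 = d) //; lia.
rewrite -exprS prednK // !scalerA -scalerBl; congr (_ *: _).
by rewrite natrB //; ring.
Qed.

(** The Laplace equation on [|x| = 1]. With gradient [Y x] along x, the Laplacian in x is
    [n Y + x . grad Y], and Euler's identity for [Y], of degree [d - 2], turns [x . grad Y] into
    [(d - 2) Y - t Y']. *)
Lemma zonal_ode d :
  ((n + d)%:R - 2) *: radial d - 'X * (radial d)^`() + (zonal d)^`()^`() = 0.
Proof.
pose A k : {poly R} := (k.*2%:R * zonal_coef d k * (n%:R + k.*2%:R - 2)) *: 'X^(d - k.*2).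
pose B k : {poly R} :=
  (zonal_coef d k * ((d - k.*2) * (d - k.*2).-1)%:R) *: 'X^(d - k.+1.*2).
rewrite -[RHS](@sum_shift_eq0 _ A B d); first last.
- move=> k; rewrite /A /B -scalerDl.
  rewrite [X in X *: _](_ : _ = 0) ?scale0r //.
  rewrite -[X in _ + X]opprK -zonal_coefS natrM natrD.
  have -> : k.+1.*2%:R = k.*2%:R + 2 :> R by rewrite doubleS -addn2 natrD.
  by ring.
- rewrite /B (_ : (d - d.*2 = 0)%N) ?mul0n ?mulr0 ?scale0r //; lia.
- by rewrite /A mul0r mul0r scale0r.
rewrite /radial /zonal !deriv_sumE scaler_sumr mulr_sumr -sumrB -big_split /=.
apply: eq_bigr => k _; rewrite /A /B !derivZ !derivXn !derivMn !derivXn -!scaler_nat.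
have [dk|dk] := ltnP d k.*2.
  by rewrite zonal_coef_small // mulr0 !mul0r !scale0r scaler0 mulr0 subr0.
rewrite [in RHS]natrM [in RHS]mulrA !scalerA (_ : (d - k.*2).-2 = d - k.+1.*2)%N; last by lia.
congr (_ + _ *: _).
rewrite -!scalerAr; have [E|dk0] := posnP (d - k.*2).
  rewrite E mulr0 scale0r subr0; congr (_ *: _).
  by rewrite (_ : n + d = n + k.*2)%N ?natrD; [ring|lia].
rewrite -exprS prednK // -scalerBl; congr (_ *: _).
by rewrite natrB // natrD; ring.
Qed.

Lemma zonal0 : zonal 0 = 1.
Proof. by rewrite /zonal big_ord1 /zonal_coef mul1r scale1r. Qed.

Lemma zonal1 : zonal 1 = 'X.
Proof.
rewrite /zonal big_ord_recl big_ord1 [X in _ + X *: _]zonal_coef_small //.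
by rewrite /zonal_coef mul1r scale1r scale0r addr0.
Qed.

Lemma radial_zonal d : radial d.+1 = d.+1%:R *: (zonal d.+1 - 'X * zonal d).
Proof. by rewrite radialE deriv_zonal scalerBr -scalerAr. Qed.

(** A Gegenbauer recurrence made homogeneous, [1 + t ^ 2] being the squared norm of [(x, t)]. It is
    [zonal_ode] with derivatives replaced by earlier terms and a factor [d + 2] cancelled. *)
Lemma zonal_rec d : (n + d)%:R *: zonal d.+2 =
  (n + d.*2.+1)%:R *: ('X * zonal d.+1) - d.+1%:R *: ((1 + 'X^2) * zonal d).
Proof.
have := zonal_ode d.+2; rewrite radial_zonal deriv_zonal !derivZ.
rewrite derivB derivM derivX !deriv_zonal -!mul_polyC !polyCB !polyC_natr => H.
have d2 : d.+2%:R != 0 :> {poly R} by rewrite -polyC_natr polyC_eq0 pnatr_eq0.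
apply: (mulfI d2); apply/eqP; rewrite -subr_eq0; apply/eqP; rewrite -[RHS]H.
by rewrite -?addnn ?addnS -!natr1 ?natrD; ring.
Qed.

(** At [(x, t)] with [|x| = 1] the gradient of the zonal form is [(radial d * x, zonal' d)]; it is
    parallel to [(x, t)] exactly when this polynomial vanishes at [t]. *)
Definition sphere_zonal d : {poly R} := (zonal d)^`() - 'X * radial d.

Lemma sphere_zonalS d :
  sphere_zonal d.+1 = d.+1%:R *: ((1 + 'X^2) * zonal d - 'X * zonal d.+1).
Proof.
rewrite /sphere_zonal radial_zonal deriv_zonal -!mul_polyC !polyC_natr; ring.
Qed.

(** Gives the exact degree of [sphere_zonal], since the leading term of [radial d.+2] is visible:
    the term k = 0 carries the factor 0, and k = 1 has degree [d]. *)
Lemma sphere_zonal_radial d :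
  d.+2%:R *: sphere_zonal d.+1 = - ((n + d)%:R *: radial d.+2).
Proof.
rewrite sphere_zonalS radial_zonal.
have := zonal_rec d; rewrite -!mul_polyC !polyC_natr => H.
apply/eqP; rewrite -subr_eq0 opprK; apply/eqP.
transitivity (d.+2%:R * ((n + d)%:R * zonal d.+2 - ((n + d.*2.+1)%:R * ('X * zonal d.+1) -
   d.+1%:R * ((1 + 'X^2) * zonal d)))); first by rewrite -?addnn ?addnS ?mulnS ?natrD ?natrM -!natr1 ?natrD; ring.
by rewrite H subrr mulr0.
Qed.

Lemma size_radial d : size (radial d.+2) = d.+1.
Proof.
have c1 : 1.*2%:R * zonal_coef d.+2 1 != 0.
  rewrite mulf_neq0 ?pnatr_eq0 // /zonal_coef mulf_neq0 ?pnatr_eq0 ?ffactnS //=.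
  by rewrite mulf_neq0 ?oppr_eq0 ?oner_eq0 // invr_eq0 pnatr_eq0; lia.
rewrite /radial big_ord_recl mul0r scale0r add0r big_ord_recl /=.
rewrite (_ : d.+2 - 1.*2 = d)%N; last by lia.
rewrite size_polyDl size_scale ?size_polyXn //.
rewrite ltnS; apply: (leq_trans (size_sum _ _ _)); apply/bigmax_leqP => i _.
have [h|h] := ltnP d.+2 (bump 0 (bump 0 i)).*2.
  by rewrite zonal_coef_small // mulr0 scale0r size_poly0.
apply: (leq_trans (size_scale_leq _ _)); rewrite size_polyXn.
by move: h; rewrite /bump /=; lia.
Qed.

Lemma size_sphere_zonal d : size (sphere_zonal d.+1) = d.+1.
Proof.
rewrite -(@size_scale _ d.+2%:R) ?pnatr_eq0 // sphere_zonal_radial size_polyN.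
by rewrite size_scale ?size_radial // pnatr_eq0; lia.
Qed.

(** As [1 + x ^ 2 > 0], the recurrence passes a common root of two consecutive terms down to
    [zonal 0 = 1]. *)
Lemma zonal_no_common_root d x : (zonal d).[x] = 0 -> (zonal d.+1).[x] <> 0.
Proof.
elim: d => [|d IH]; first by rewrite zonal0 hornerC => /eqP; rewrite oner_eq0.
move=> H1 H2; apply: (IH _ H1).
have := congr1 (horner^~ x) (zonal_rec d).
rewrite hornerD hornerN !hornerZ !hornerM H1 H2 !mulr0 sub0r => /eqP.
rewrite eq_sym oppr_eq0 mulf_eq0 pnatr_eq0 /= mulf_eq0 !hornerE => /orP[|/eqP //].
by have := sqr_ge0 x; nra.
Qed.

Lemma deriv_sphere_zonal d :
  (sphere_zonal d.+2)^`() = (d.+2 * (n + d.+1))%:R *: ('X * zonal d.+1 - zonal d.+2).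
Proof.
rewrite sphere_zonalS !derivZ derivB !derivM derivX derivD derivXn !deriv_zonal.
rewrite -[X in deriv X]polyC1 derivC.
have := zonal_rec d; rewrite -!mul_polyC !polyC_natr => H.
apply/eqP; rewrite -subr_eq0; apply/eqP.
transitivity (d.+2%:R * ((n + d)%:R * zonal d.+2 - ((n + d.*2.+1)%:R * ('X * zonal d.+1) -
   d.+1%:R * ((1 + 'X^2) * zonal d)))); first by rewrite -?addnn ?addnS ?mulnS ?natrD ?natrM -!natr1 ?natrD; ring.
by rewrite H subrr mulr0.
Qed.

Lemma sphere_zonal_simple d x :
  root (sphere_zonal d.+2) x -> (sphere_zonal d.+2)^`().[x] != 0.
Proof.
rewrite deriv_sphere_zonal sphere_zonalS rootZ ?pnatr_eq0 // rootE.
rewrite !hornerE => /eqP H1.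
rewrite mulf_neq0 ?pnatr_eq0 //; first by lia.
(* Subtracting [x] times the derivative relation from the root relation isolates [zonal d.+1]; then
   [zonal d.+2] vanishes at [x] as well. *)
apply/eqP => H2; have z1 : (zonal d.+1).[x] = 0.
  transitivity ((1 + x ^+ 2) * (zonal d.+1).[x] - x * (zonal d.+2).[x]
    - x * (x * (zonal d.+1).[x] - (zonal d.+2).[x])); first by ring.
  by rewrite H1 H2; ring.
by apply: (zonal_no_common_root z1); move: H2; rewrite z1 => H2; lra.
Qed.

(* Used with s = t - zonal d.+1 / zonal d: by the recurrence the map
   s |-> (1 + t s) / (t - s) is, up to a positive factor, the passage from d to
   d + 1, so s stays on the real axis or on the side opposite to t. *)
Lemma im_cayley (t s : R[i]) : complex.Im t * complex.Im s <= 0 ->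
  complex.Im t != 0 -> complex.Im t * complex.Im ((1 + t * s) / (t - s)) < 0.
Proof.
case: t s => a b [c e] H b0; have {}H : b * e <= 0 := H.
have b2 : 0 < b ^+ 2 by rewrite exprn_even_gt0.
have N0 : 0 < (a - c) ^+ 2 + (b - e) ^+ 2.
  rewrite ltr_wpDl ?sqr_ge0 // exprn_even_gt0 //= subr_eq0.
  by apply: contraTneq H => <-; rewrite -ltNge -expr2.
set w := _ / _.
have -> : complex.Im w =
    (e - b + e * (a ^+ 2 + b ^+ 2) - b * (c ^+ 2 + e ^+ 2)) /
    ((a - c) ^+ 2 + (b - e) ^+ 2).
  by rewrite /w; simpc; rewrite /=; field; rewrite gt_eqF.
rewrite mulrA pmulr_llt0 ?invr_gt0 //.
have -> : b * (e - b + e * (a ^+ 2 + b ^+ 2) - b * (c ^+ 2 + e ^+ 2)) =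
  (b * e) * (1 + a ^+ 2 + b ^+ 2) - b ^+ 2 * (1 + c ^+ 2 + e ^+ 2) by ring.
have h : b * e * (1 + a ^+ 2 + b ^+ 2) <= 0.
  by rewrite mulr_le0_ge0 // !addr_ge0 ?ler01 ?sqr_ge0.
rewrite subr_lt0 (le_lt_trans h) // mulr_gt0 // -addrA ltr_pwDl ?ltr01 //.
by rewrite addr_ge0 ?sqr_ge0.
Qed.

Local Notation zonalC d t := (map_poly toC (zonal d)).[t].

Lemma map_poly_1DX2 : map_poly toC (1 + 'X^2) = 1 + 'X^2.
Proof. by rewrite rmorphD rmorph1 /= map_polyXn. Qed.

Lemma zonalC_rec (t : R[i]) d : (n + d)%:R * zonalC d.+2 t =
  (n + d.*2.+1)%:R * (t * zonalC d.+1 t) - d.+1%:R * ((1 + t ^+ 2) * zonalC d t).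
Proof.
have := congr1 (fun p => (map_poly toC p).[t]) (zonal_rec d).
rewrite /= rmorphB /= !map_polyZ !rmorphM /= map_poly_1DX2 map_polyX.
rewrite hornerD hornerN !hornerZ !hornerM hornerD hornerXn hornerX hornerC.
by rewrite !(rmorph_nat toC).
Qed.

(** The two claims need each other: a nonzero denominator makes the quotient meaningful, and the
    half-plane condition gives [s != t], hence the next nonzero value. *)
Lemma zonalC_neq0 (t : R[i]) d : complex.Im t != 0 ->
  zonalC d t != 0 /\
  complex.Im t * complex.Im (t - zonalC d.+1 t / zonalC d t) <= 0.
Proof.
move=> t0; elim: d => [|d [z0 IH]].
  rewrite zonal0 zonal1 rmorph1 map_polyX hornerC hornerX divr1 subrr /= mulr0.
  by rewrite oner_neq0.
set s := t - _ in IH.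
have Zd : zonalC d.+1 t = (t - s) * zonalC d t by rewrite /s; field.
have ts : t - s != 0.
  apply: contraTneq IH => /eqP; rewrite subr_eq0 => /eqP <-.
  by rewrite -ltNge -expr2 exprn_even_gt0.
have z1 : zonalC d.+1 t != 0 by rewrite Zd mulf_neq0.
split=> //.
have nd : (n + d)%:R != 0 :> R[i] by rewrite pnatr_eq0; lia.
have -> : t - zonalC d.+2 t / zonalC d.+1 t =
    toC (d.+1%:R / (n + d)%:R) * ((1 + t * s) / (t - s)).
  rewrite fmorph_div !rmorph_nat.
  have -> : zonalC d.+2 t = ((n + d.*2.+1)%:R * (t * zonalC d.+1 t) -
      d.+1%:R * ((1 + t ^+ 2) * zonalC d t)) / (n + d)%:R.
    by rewrite -zonalC_rec mulrC mulKf.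
  rewrite Zd -addnn !addnS -!natr1 !natrD; field.
  by rewrite ts -natrD nd z0.
have imZ (c : R) (w : R[i]) : complex.Im (toC c * w) = c * complex.Im w.
  by case: w => u v; simpc.
have /ltW h := im_cayley IH t0.
by rewrite imZ mulrCA mulr_ge0_le0 // divr_ge0 // ler0n.
Qed.

(** For non-real [t] the value is a nonzero multiple of [1 + t * s]; were that 0, the strict
    inequality of [im_cayley] would read [0 < 0]. *)
Lemma sphere_zonal_real (t : R[i]) d :
  root (map_poly toC (sphere_zonal d.+1)) t -> complex.Im t = 0.
Proof.
move=> rt; apply/eqP; apply: contraTT rt => t0; rewrite rootE.
have [z0 H] := zonalC_neq0 d t0.
set s := t - _ in H; have := im_cayley H t0.
have Zd : zonalC d.+1 t = (t - s) * zonalC d t by rewrite /s; field.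
move=> H1; rewrite sphere_zonalS.
rewrite map_polyZ rmorphB !rmorphM /= map_poly_1DX2 map_polyX.
rewrite hornerZ hornerD hornerN !hornerM hornerD hornerXn hornerX hornerC.
rewrite (rmorph_nat toC) Zd.
have -> : d.+1%:R * ((1 + t ^+ 2) * zonalC d t - t * ((t - s) * zonalC d t)) =
  d.+1%:R * zonalC d t * (1 + t * s) by ring.
rewrite !mulf_neq0 ?pnatr_eq0 //.
by apply: contraTneq H1 => ->; rewrite mul0r /= mulr0 ltxx.
Qed.

Lemma sphere_zonal_split d : exists s, simply_split (sphere_zonal d.+2) s.
Proof.
apply: simply_split_real.
- by rewrite -size_poly_gt0 size_sphere_zonal.
- by move=> z; apply: sphere_zonal_real.
- by move=> x; apply: sphere_zonal_simple.
Qed.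

End Zonal.

(** * Gradients, Hessians and eigenvectors *)

Section ChainRule.
Variables (n : nat) (R S : fieldType) (phi : {rmorphism R -> S}).

Lemma submm (m : 'X_{1..n}) : (m - m = 0)%MM.
Proof. by rewrite -{1}(add0m m) addmK. Qed.

Lemma deriv_mmap (g : 'I_n -> {poly S}) (f : {mpoly R[n]}) :
  (mmap (polyC \o phi) g f)^`() =
  \sum_i mmap (polyC \o phi) g f^`M(i) * (g i)^`().
Proof.
pose K (f : {mpoly R[n]}) := (mmap (polyC \o phi) g f)^`() =
  \sum_i mmap (polyC \o phi) g f^`M(i) * (g i)^`().
have K1 : K 1.
  rewrite /K rmorph1 -[X in deriv X]polyC1 derivC big1 // => i _.
  by rewrite -mpolyC1 mderivC mmap0 mul0r.
have KX i : K 'X_i.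
  rewrite /K mmapX mmap1U (bigD1 i) //= mderivX mnm1E eqxx submm mpolyX0 scale1r.
  rewrite rmorph1 mul1r big1 ?addr0 // => j ji.
  by rewrite mderivX mnm1E eq_sym (negbTE ji) scale0r mmap0 mul0r.
have KM p q : K p -> K q -> K (p * q).
  rewrite /K => Hp Hq; rewrite rmorphM derivM Hp Hq mulr_suml mulr_sumr -big_split.
  by apply: eq_bigr => i _; rewrite /= mderivM mmapD !rmorphM /=; ring.
have KXm m : K 'X_[m].
  rewrite mpolyXE_id; apply: (big_ind K) => // i _.
  by elim: (m i) => // k IH; rewrite exprS; apply: KM.
rewrite -/(K f); elim/mpolyind: f => [|c m p _ _ IH].
  by rewrite /K mmap0 deriv0 big1 // => i _; rewrite mderiv0 mmap0 mul0r.
rewrite /K mmapD derivD IH mmapZ /= mul_polyC derivZ KXm scaler_sumr -big_split /=.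
by apply: eq_bigr => i _; rewrite mderivD mderivZ mmapD mmapZ mulrDl -mulrA mul_polyC.
Qed.

Lemma horner_mmap (g : 'I_n -> {poly S}) (f : {mpoly R[n]}) t :
  (mmap (polyC \o phi) g f).[t] = mmap phi (fun i => (g i).[t]) f.
Proof.
rewrite /mmap horner_sum; apply: eq_bigr => m _.
rewrite hornerM /= hornerC /mmap1 horner_prod; congr (_ * _).
by apply: eq_bigr => i _; rewrite horner_exp.
Qed.

Lemma mderiv_exp (f : {mpoly R[n]}) k i :
  (f ^+ k)^`M(i) = k%:R * f ^+ k.-1 * f^`M(i).
Proof.
elim: k => [|k IH]; first by rewrite expr0 -mpolyC1 mderivC !mul0r.
rewrite exprS mderivM IH; case: k {IH} => [|k]; first by rewrite !expr0; ring.
by rewrite /= -!natr1 exprS; ring.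
Qed.

Lemma mderivXU i j : ('X_j : {mpoly R[n]})^`M(i) = (i == j)%:R.
Proof.
rewrite mderivX mnm1E eq_sym; case: eqVneq => [->|]; last by rewrite scale0r.
by rewrite submm mpolyX0 scale1r.
Qed.

End ChainRule.

Section Gradient.
Variables (n : nat) (R S : fieldType) (phi : {rmorphism R -> S}).
Implicit Types (f : {mpoly R[n]}) (z : 'rV[S]_n).

(** Evaluation through [phi] lets one real form have its gradient taken at real and at complex
    points. *)
Definition grad f z : 'rV[S]_n := \row_i mmap phi (z 0) f^`M(i).

Lemma gradZ f d c z : f \is d.+1.-homog -> grad f (c *: z) = c ^+ d *: grad f z.
Proof.
move=> hf; apply/rowP => i; rewrite !mxE -mmap_homog ?dhomog_mderiv //.
by apply: mmap_ext => j; rewrite !mxE.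
Qed.

Lemma eigen_scale f d c z l : f \is d.+1.-homog -> c != 0 ->
  grad f z = l *: z -> exists l', grad f (c *: z) = l' *: (c *: z).
Proof.
move=> hf c0 h; exists (c ^+ d * l / c).
by rewrite (gradZ _ _ hf) h !scalerA divfK.
Qed.

End Gradient.

Section Hessian.
Variables (n : nat) (R : fieldType).
Implicit Types (f : {mpoly R[n]}) (x v : 'rV[R]_n).
Local Notation grad := (grad (@idfun R)).

Definition hess f x : 'M[R]_n := \matrix_(i, j) mmap idfun (x 0) f^`M(i)^`M(j).

(* Non-degeneracy of the eigenpoint <[x]>: the Hessian minus the eigenvalue is
   injective modulo x.  It does not require x to be a unit vector. *)
Definition regular f x := forall l mu v, grad f x = l *: x ->
  v *m hess f x = l *: v + mu *: x -> (v <= x)%MS.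

Lemma hessZ f d c x : f \is d.+2.-homog -> hess f (c *: x) = c ^+ d *: hess f x.
Proof.
move=> hf; apply/matrixP => i j.
rewrite !mxE -(mmap_homog idfun c (x 0) (d := d)); last by do 2!apply: dhomog_mderiv.
by apply: mmap_ext => k; rewrite !mxE.
Qed.

(** Euler's identity for the partial derivatives. An eigenvector is thus an eigenvector of its own
    Hessian, which allows multiples of [x] to be removed from a vector tested in [regular]. *)
Lemma hess_euler f d x : f \is d.+1.-homog -> x *m hess f x = d%:R *: grad f x.
Proof.
move=> hf; apply/rowP => j; rewrite !mxE.
have := congr1 (mmap idfun (x 0)) (mpoly_euler (dhomog_mderiv j hf)).
rewrite mmapMn mulr_natl => <-; rewrite raddf_sum; apply: eq_bigr => i _.
by rewrite /= mxE rmorphM /= mmapX mmap1U mderiv_comm.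
Qed.

Lemma regularZ f d c x : f \is d.+1.-homog -> c != 0 ->
  regular f x -> regular f (c *: x).
Proof.
move=> hf c0 rx l mu v.
have c1 : c ^+ d != 0 by rewrite expf_neq0.
(* The Hessian scales by [c ^ (d - 1)]; the extra factor [c] avoids this exponent for [d = 0], where
   the form is linear and the Hessian is 0. *)
have hessc : c *: hess f (c *: x) = c ^+ d *: hess f x.
  case: d hf {c1} => [|d] hf; last by rewrite (hessZ _ _ hf) scalerA -exprS.
  suff hess0 y : hess f y = 0 by rewrite !hess0 !scaler0.
  by apply/matrixP => i j; rewrite !mxE (mderiv_homog0 _ (dhomog_mderiv i hf)) mmap0.
rewrite (gradZ _ _ _ hf) => hl hv.
have gx : grad f x = (l * c / c ^+ d) *: x.
  by apply: (scalerI c1); rewrite hl !scalerA; congr (_ *: _); field.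
have hx : v *m hess f x = (l * c / c ^+ d) *: v + (mu * c ^+ 2 / c ^+ d) *: x.
  apply: (scalerI c1); rewrite scalemxAr -hessc -scalemxAr hv !scalerDr !scalerA.
  by congr (_ *: _ + _ *: _); field.
have /sub_rVP[a ->] := rx _ _ _ gx hx.
by apply/sub_rVP; exists (a / c); rewrite scalerA divfK.
Qed.

End Hessian.

Section Extension.
Variables (n : nat).
Local Notation widen := (widen_ord (leqnSn n)).

Definition ext (F : fieldType) (w : 'rV[F]_n) (t : F) : 'rV[F]_n.+1 :=
  \row_i if unlift ord_max i is Some j then w 0 j else t.

Lemma widen_lift (i : 'I_n) : widen i = lift ord_max i.
Proof. by apply/val_inj; rewrite /= /bump leqNgt ltn_ord. Qed.

Section Field.
Variable F : fieldType.
Implicit Types (w : 'rV[F]_n) (t : F).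

Lemma ext_widen w t i : ext w t 0 (widen i) = w 0 i.
Proof. by rewrite mxE widen_lift liftK. Qed.

Lemma ext_max w t : ext w t 0 ord_max = t.
Proof. by rewrite mxE unlift_none. Qed.

Lemma ext_rowP (x y : 'rV[F]_n.+1) : x 0 ord_max = y 0 ord_max ->
  (forall i, x 0 (widen i) = y 0 (widen i)) -> x = y.
Proof.
move=> hm hw; apply/rowP => i; have [j ->|->//] := unliftP ord_max i.
by rewrite -widen_lift.
Qed.

Lemma ext_surj (x : 'rV[F]_n.+1) : x = ext (\row_i x 0 (widen i)) (x 0 ord_max).
Proof. by apply: ext_rowP => [|i]; rewrite ?ext_max // ext_widen mxE. Qed.

Lemma ext_inj w t w' t' : ext w t = ext w' t' -> w = w' /\ t = t'.
Proof.
move=> E; split; last by rewrite -(ext_max w t) E ext_max.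
by apply/rowP => i; rewrite -(ext_widen w t) E ext_widen.
Qed.

Lemma extZ c w t : c *: ext w t = ext (c *: w) (c * t).
Proof. by apply: ext_rowP => [|i]; rewrite !(ext_widen, ext_max, mxE). Qed.

Lemma extD w t w' t' : ext w t + ext w' t' = ext (w + w') (t + t').
Proof. by apply: ext_rowP => [|i]; rewrite !(ext_widen, ext_max, mxE). Qed.

Lemma ext0 : ext 0 0 = 0 :> 'rV[F]_n.+1.
Proof. by apply: ext_rowP => [|i]; rewrite !(ext_widen, ext_max, mxE). Qed.

End Field.

Lemma map_ext (F G : fieldType) (phi : {rmorphism F -> G}) w t :
  map_mx phi (ext w t) = ext (map_mx phi w) (phi t).
Proof. by apply: ext_rowP => [|i]; rewrite mxE !(ext_widen, ext_max, mxE). Qed.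

End Extension.

(** * The inductive construction *)

Section ZonalMpoly.
Variables (R : rcfType) (n : nat).
Hypothesis n_gt0 : (0 < n)%N.
Local Notation widen := (widen_ord (leqnSn n)).
Local Notation T := ('X_ord_max : {mpoly R[n.+1]}).

Definition sqnorm : {mpoly R[n.+1]} := \sum_(i < n) 'X_(widen i) ^+ 2.
Local Notation P := sqnorm.

Definition zonal_mpoly d : {mpoly R[n.+1]} :=
  \sum_(k < d.+1) zonal_coef R n d k *: (T ^+ (d - k.*2) * P ^+ k).

Definition radial_mpoly d : {mpoly R[n.+1]} :=
  \sum_(k < d.+1) (k.*2%:R * zonal_coef R n d k) *: (T ^+ (d - k.*2) * P ^+ k.-1).

(** It is to [radial_mpoly] what [radial_mpoly] is to [zonal_mpoly]. The truncations in [k.-1] and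
    [k.-2] take effect only where a factor [2 k] or [2 (k - 1)] is 0. *)
Definition radial2_mpoly d : {mpoly R[n.+1]} :=
  \sum_(k < d.+1) (k.*2%:R * (k.-1).*2%:R * zonal_coef R n d k) *:
    (T ^+ (d - k.*2) * P ^+ k.-2).

Lemma mderiv_sumE m (I : Type) (r : seq I) (Q : pred I) (F : I -> {mpoly R[m]}) i :
  (\sum_(j <- r | Q j) F j)^`M(i) = \sum_(j <- r | Q j) (F j)^`M(i).
Proof. exact: raddf_sum. Qed.

Lemma mderiv_sqnorm_max : P^`M(ord_max) = 0.
Proof.
rewrite raddf_sum big1 //= => i _; rewrite mderiv_exp mderivXU.
by rewrite -val_eqE /= gtn_eqF ?mulr0.
Qed.

Lemma mderiv_sqnorm i : P^`M(widen i) = 'X_(widen i) *+ 2.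
Proof.
rewrite raddf_sum (bigD1 i) //= big1 => [|j ji]; rewrite mderiv_exp mderivXU.
  by rewrite eqxx mulr1 expr1 addr0 mulr_natl.
by rewrite -val_eqE /= val_eqE eq_sym (negbTE ji) mulr0.
Qed.

Lemma mderiv_last_widen i : T^`M(widen i) = 0.
Proof. by rewrite mderivXU -val_eqE /= ltn_eqF. Qed.

Lemma mderiv_zonal_mpoly d i :
  (zonal_mpoly d)^`M(widen i) = 'X_(widen i) * radial_mpoly d.
Proof.
rewrite raddf_sum mulr_sumr; apply: eq_bigr => k _ /=.
rewrite mderivZ mderivM !mderiv_exp mderiv_last_widen mderiv_sqnorm.
by move: (zonal_coef R n d k) => a; rewrite -!mul_mpolyC mpolyCM mpolyC_nat -mul2n natrM; ring.
Qed.

Lemma mderiv_radial_mpoly d i :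
  (radial_mpoly d)^`M(widen i) = 'X_(widen i) * radial2_mpoly d.
Proof.
rewrite raddf_sum mulr_sumr; apply: eq_bigr => k _ /=.
rewrite mderivZ mderivM !mderiv_exp mderiv_last_widen mderiv_sqnorm.
by move: (zonal_coef R n d k) => a; rewrite -!mul_mpolyC !mpolyCM !mpolyC_nat -!mul2n !natrM; ring.
Qed.

Lemma dhomog_var m (i : 'I_m) : ('X_i : {mpoly R[m]}) \is 1.-homog.
Proof. by rewrite dhomogX /= mdeg1. Qed.

Lemma dhomog_sqnorm : P \is 2.-homog.
Proof. by apply: rpred_sum => i _; apply: (dhomogMn (d := 1) 2); apply: dhomog_var. Qed.

Lemma dhomog_zonal_mpoly d : zonal_mpoly d \is d.-homog.
Proof.
apply: rpred_sum => k _.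
have [dk|dk] := ltnP d k.*2.
  by rewrite zonal_coef_small // scale0r rpred0.
apply: rpredZ; have E : (1 * (d - k.*2) + 2 * k = d)%N by lia.
have := dhomogM (dhomogMn (d - k.*2) (dhomog_var ord_max)) (dhomogMn k dhomog_sqnorm).
by rewrite E.
Qed.

Lemma harmonic_zonal_mpoly d :
  \sum_(i < n.+1) (zonal_mpoly d)^`M(i)^`M(i) = 0.
Proof.
pose A k : {mpoly R[n.+1]} :=
  (zonal_coef R n d k * (k.*2 * ((k.-1).*2 + n))%:R) *: (T ^+ (d - k.*2) * P ^+ k.-1).
pose B k : {mpoly R[n.+1]} :=
  (zonal_coef R n d k * ((d - k.*2) * (d - k.*2).-1)%:R) *: (T ^+ (d - k.+1.*2) * P ^+ k).
rewrite -[RHS](@sum_shift_eq0 _ A B d); first last.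
- move=> k; rewrite /A /B -scalerDl.
  by rewrite [k.+1.-1]/= zonal_coefS // addNr scale0r.
- by rewrite /B (_ : (d - d.*2 = 0)%N) ?mul0n ?mulr0 ?scale0r //; lia.
- by rewrite /A mul0n mulr0 scale0r.
rewrite big_ord_recr big_split /=; congr (_ + _).
  (* The Laplacian in x is n times [radial_mpoly] plus [P] times [radial2_mpoly]; the factor [P]
     raises the exponent [k - 2] back to [k - 1]. *)
  rewrite (eq_bigr (fun i => radial_mpoly d + 'X_(widen i) ^+ 2 * radial2_mpoly d)).
    rewrite big_split /= -mulr_suml -/P sumr_const card_ord -mulr_natr mulr_suml.
    rewrite mulr_sumr -big_split; apply: eq_bigr => -[k /= _] _; rewrite /A.
    case: k => [|k]; first by rewrite ?mul0n ?mulr0 ?mul0r ?scale0r ?mulr0 ?mul0r ?addr0.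
    move: (zonal_coef R n d k.+1) => a.
    rewrite -!mul_mpolyC !mpolyCM !mpolyC_nat natrM natrD [k.+1.-1]/=.
    case: k => [|k]; first by rewrite !expr0 double0; ring.
    by rewrite [P ^+ k.+1]exprS [k.+2.-2]/=; ring.
  move=> i _; rewrite mderiv_zonal_mpoly mderivM mderivXU eqxx mul1r.
  by rewrite mderiv_radial_mpoly mulrA.
have -> : (zonal_mpoly d)^`M(ord_max) = \sum_(k < d.+1)
    (zonal_coef R n d k *: (T ^+ (d - k.*2) * P ^+ k))^`M(ord_max).
  exact: mderiv_sumE.
rewrite mderiv_sumE; apply: eq_bigr => k _; rewrite !mderivZ /B.
rewrite mderivM !mderiv_exp mderivXU mderiv_sqnorm_max eqxx !mulr0 addr0 mulr1.
rewrite -mulrA -mpolyC_nat mderiv_mulC mderivM !mderiv_exp mderivXU.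
rewrite mderiv_sqnorm_max eqxx !mulr0 addr0 mulr1.
rewrite (_ : (d - k.+1.*2 = (d - k.*2).-2)%N); last by lia.
move: (zonal_coef R n d k) => a.
by rewrite -!mul_mpolyC !mpolyCM !mpolyC_nat natrM; ring.
Qed.

Section Slice.
Variables (S : fieldType) (phi : {rmorphism R -> S}) (w : 'rV[S]_n).
Hypothesis unit_w : \sum_i w 0 i ^+ 2 = 1.

(* Restriction to the affine line {(w, t)} as a polynomial in t. *)
Definition slice_point (i : 'I_n.+1) : {poly S} :=
  if unlift ord_max i is Some j then (w 0 j)%:P else 'X.

Definition slice (f : {mpoly R[n.+1]}) : {poly S} :=
  mmap (polyC \o phi) slice_point f.

Lemma slice_max : slice_point ord_max = 'X.
Proof. by rewrite /slice_point unlift_none. Qed.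

Lemma slice_widen i : slice_point (widen i) = (w 0 i)%:P.
Proof. by rewrite /slice_point widen_lift liftK. Qed.

Lemma deriv_slice f : (slice f)^`() = slice f^`M(ord_max).
Proof.
rewrite /slice deriv_mmap big_ord_recr /= slice_max derivX mulr1 big1 ?add0r //.
by move=> i _; rewrite slice_widen derivC mulr0.
Qed.

Lemma horner_slice f t : (slice f).[t] = mmap phi (ext w t 0) f.
Proof.
rewrite /slice horner_mmap; apply: mmap_ext => i; rewrite /slice_point mxE.
by case: unlift => [j|]; rewrite ?hornerC ?hornerX.
Qed.

(** A unit [w] turns every power of [P] into 1, so one statement with arbitrary exponents [k] serves
    both the zonal and the radial form. *)
Lemma slice_sum_monomials (c : nat -> R) (e k : nat -> nat) N :
  slice (\sum_(i < N) c i *: (T ^+ e i * P ^+ k i)) =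
  map_poly phi (\sum_(i < N) c i *: 'X^(e i)).
Proof.
have sP : slice P = 1.
  rewrite /slice raddf_sum -[RHS]polyC1 -unit_w rmorph_sum; apply: eq_bigr => i _ /=.
  by rewrite rmorphXn /= mmapX mmap1U slice_widen -rmorphXn.
rewrite /slice !raddf_sum; apply: eq_bigr => i _ /=.
rewrite mmapZ rmorphM !rmorphXn /= (sP : mmap _ _ P = 1) expr1n mulr1.
rewrite mmapX mmap1U slice_max.
by rewrite map_polyZ map_polyXn mul_polyC.
Qed.

Lemma slice_zonal d : slice (zonal_mpoly d) = map_poly phi (zonal R n d).
Proof. exact: (slice_sum_monomials (zonal_coef R n d) (fun k => d - k.*2)%N id). Qed.

Lemma slice_radial d : slice (radial_mpoly d) = map_poly phi (radial R n d).
Proof.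
exact: (slice_sum_monomials (fun k => k.*2%:R * zonal_coef R n d k)
  (fun k => d - k.*2)%N predn).
Qed.

End Slice.

End ZonalMpoly.

(** * Complete lists of real non-degenerate eigenpoints *)

Section RealConfiguration.
Variables (R : realType).
Local Notation toC := (real_complex R).

(** The invariant of the induction: one unit vector per eigenpoint, the second clause excluding
    antipodes too. The last clause ranges over complex vectors, so that no eigenpoint is missed and
    none is non-real. *)
Definition real_configuration n (f : {mpoly R[n]}) (s : seq 'rV[R]_n) : Prop :=
  [/\ uniq s,
      {in s &, forall x y, (x <= y)%MS -> x = y},
      {in s, forall x,
        [/\ dot x x = 1, exists l, grad idfun f x = l *: x & regular f x]}
    & forall z : 'rV[R[i]]_n, z != 0 -> (exists l, grad toC f z = l *: z) ->
      exists2 x, x \in s & (z <= map_mx toC x)%MS].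

Lemma dot_eq0 n (x : 'rV[R]_n) : (dot x x == 0) = (x == 0).
Proof.
apply/eqP/eqP => [/psumr_eq0P H|->]; last by rewrite /dot big1 // => i _; rewrite mxE mul0r.
apply/rowP => i; rewrite mxE; apply/eqP; rewrite -sqrf_eq0 expr2 H // => j _.
by rewrite -expr2 sqr_ge0.
Qed.

Lemma unit_neq0 n (x : 'rV[R]_n) : dot x x = 1 -> x != 0.
Proof. by move=> x1; rewrite -dot_eq0 x1 oner_eq0. Qed.

Lemma dot_ge0 n (x : 'rV[R]_n) : 0 <= dot x x.
Proof. by apply: sumr_ge0 => i _; rewrite -expr2 sqr_ge0. Qed.

Lemma dotZ n a b (x y : 'rV[R]_n) : dot (a *: x) (b *: y) = a * b * dot x y.
Proof. by rewrite /dot mulr_sumr; apply: eq_bigr => i _; rewrite !mxE; ring. Qed.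

Definition normalize n (x : 'rV[R]_n) := (Num.sqrt (dot x x))^-1 *: x.

Lemma dot_normalize n (x : 'rV[R]_n) : x != 0 -> dot (normalize x) (normalize x) = 1.
Proof.
move=> x0; rewrite dotZ -expr2 exprVn sqr_sqrtr ?dot_ge0 // mulVf //.
by rewrite dot_eq0.
Qed.

Lemma normalize_coef_neq0 n (x : 'rV[R]_n) : x != 0 -> (Num.sqrt (dot x x))^-1 != 0.
Proof.
by move=> x0; rewrite invr_eq0 sqrtr_eq0 -ltNge lt_neqAle eq_sym dot_eq0 x0 dot_ge0.
Qed.

Lemma eqmx_normalize n (x : 'rV[R]_n) : x != 0 -> (normalize x :=: x)%MS.
Proof. by move=> x0; apply: eqmx_scale; apply: normalize_coef_neq0. Qed.

Lemma real_configuration_normalize n d (f : {mpoly R[n]}) (s : seq 'rV[R]_n) :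
  f \is d.+1.-homog -> uniq s -> {in s &, forall x y, (x <= y)%MS -> x = y} ->
  {in s, forall x, [/\ x != 0, exists l, grad idfun f x = l *: x & regular f x]} ->
  (forall z : 'rV[R[i]]_n, z != 0 -> (exists l, grad toC f z = l *: z) ->
      exists2 x, x \in s & (z <= map_mx toC x)%MS) ->
  real_configuration f (map (@normalize n) s).
Proof.
move=> hf us prop sP compl.
have propN : {in s &, forall x y, (normalize x <= normalize y)%MS -> x = y}.
  move=> x y xs ys; have [x0 _ _] := sP x xs; have [y0 _ _] := sP y ys.
  by rewrite (eqmx_normalize x0) (eqmx_normalize y0); apply: prop.
split.
- by rewrite map_inj_in_uniq // => x y xs ys E; apply: propN; rewrite // E.
- by move=> _ _ /mapP[x xs ->] /mapP[y ys ->] /propN ->.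
- move=> _ /mapP[x xs ->]; have [x0 [l gx] rx] := sP x xs.
  have c0 := normalize_coef_neq0 x0; split; first exact: dot_normalize.
    exact: (eigen_scale hf c0 gx).
  exact: (regularZ hf c0 rx).
- move=> z z0 /(compl z z0) [x xs zx]; exists (normalize x); first exact: map_f.
  have [x0 _ _] := sP x xs; apply: (submx_trans zx).
  rewrite /normalize map_mxZ eqmx_scale // fmorph_eq0; exact: normalize_coef_neq0.
Qed.

End RealConfiguration.

(** * Eigenpoints and non-degeneracy in one induction step *)

Section Step.
Variables (R : realType) (n d : nat).
Hypothesis n_gt0 : (0 < n)%N.
Local Notation toC := (real_complex R).
Local Notation widen := (widen_ord (leqnSn n)).
Variables (h : {mpoly R[n]}) (e : R).

Local Notation Z := (zonal_mpoly R n d.+2).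
Local Notation Y := (radial_mpoly R n d.+2).
Local Notation Y2 := (radial2_mpoly R n d.+2).

Definition step_mpoly : {mpoly R[n.+1]} := Z + e *: mwiden h.
Local Notation f := step_mpoly.

Lemma mderiv_step_widen i : f^`M(widen i) = 'X_(widen i) * Y + e *: mwiden h^`M(i).
Proof. by rewrite mderivD mderivZ mderiv_zonal_mpoly mderiv_mwiden. Qed.

Lemma mderiv_step_max : f^`M(ord_max) = Z^`M(ord_max).
Proof. by rewrite mderivD mderivZ mderiv_mwiden_max scaler0 addr0. Qed.

Lemma mmap_mwiden_ext (S : fieldType) (phi : {rmorphism R -> S}) w t (p : {mpoly R[n]}) :
  mmap phi (ext w t 0) (mwiden p) = mmap phi (w 0) p.
Proof. by rewrite mmap_mwiden; apply: mmap_ext => i; rewrite ext_widen. Qed.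

Lemma grad_step (S : fieldType) (phi : {rmorphism R -> S}) w t :
  grad phi f (ext w t) =
  ext (mmap phi (ext w t 0) Y *: w + phi e *: grad phi h w)
      (mmap phi (ext w t 0) Z^`M(ord_max)).
Proof.
apply: ext_rowP => [|i]; rewrite ?ext_max ?ext_widen mxE.
  by rewrite mderiv_step_max.
rewrite mderiv_step_widen mmapD mmapZ rmorphM /= mmapX mmap1U mmap_mwiden_ext.
by rewrite ext_widen !mxE mulrC.
Qed.

Lemma hess_step u t v s :
  let ev := mmap idfun (ext u t 0) in
  ext v s *m hess f (ext u t) =
  ext (ev Y *: v + (ev Y2 * dot u v + s * ev Y^`M(ord_max)) *: u + e *: (v *m hess h u))
      (dot u v * ev Y^`M(ord_max) + s * ev Z^`M(ord_max)^`M(ord_max)).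
Proof.
move=> ev.
have evX i : ev 'X_(widen i) = u 0 i by rewrite /ev mmapX mmap1U ext_widen.
have evM p q : ev (p * q) = ev p * ev q by rewrite /ev rmorphM.
have evh p : ev (mwiden p) = mmap idfun (u 0) p by rewrite /ev mmap_mwiden_ext.
have evD p q : ev (p + q) = ev p + ev q by rewrite /ev mmapD.
have evZ c p : ev (c *: p) = c * ev p by rewrite /ev mmapZ.
have evN (b : bool) : ev b%:R = b%:R by rewrite /ev rmorph_nat.
apply: ext_rowP => [|i]; rewrite ?ext_max ?ext_widen mxE big_ord_recr /= ext_max.
  rewrite !mxE mderiv_step_max; congr (_ + _); rewrite /dot mulr_suml.
  apply: eq_bigr => j _; rewrite ext_widen mxE mderiv_step_widen.
  rewrite mderivD mderivZ mderiv_mwiden_max scaler0 addr0 mderivM mderivXU.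
  rewrite -val_eqE /= gtn_eqF // mul0r add0r -/ev evM evX; ring.
rewrite !mxE mderiv_step_max mderiv_comm mderiv_zonal_mpoly mderivM mderivXU.
rewrite -val_eqE /= gtn_eqF // mul0r add0r -/ev evM evX.
have term j : ext v s 0 (widen j) * hess f (ext u t) (widen j) (widen i) =
    (i == j)%:R * v 0 j * ev Y + u 0 j * v 0 j * (u 0 i * ev Y2) +
    e * (v 0 j * hess h u j i).
  rewrite ext_widen !mxE mderiv_step_widen mderivD mderivZ mderiv_mwiden mderivM.
  rewrite mderiv_radial_mpoly mderivXU -/ev !evD evZ !evM !evX evh evN.
  by rewrite -val_eqE /= val_eqE; ring.
rewrite (eq_bigr _ (fun j _ => term j)) !big_split /= -mulr_sumr.
rewrite -!mulr_suml -/(dot u v).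
have -> : \sum_j (i == j)%:R * v 0 j = v 0 i.
  rewrite (bigD1 i) //= eqxx mul1r big1 ?addr0 // => j ji.
  by rewrite eq_sym (negbTE ji) mul0r.
by ring.
Qed.

Lemma mmap_map (S : fieldType) (phi : {rmorphism R -> S}) m (x : 'rV[R]_m)
    (p : {mpoly R[m]}) :
  mmap phi (map_mx phi x 0) p = phi (mmap idfun (x 0) p).
Proof.
rewrite /mmap rmorph_sum; apply: eq_bigr => k _; rewrite rmorphM /mmap1 rmorph_prod.
by congr (_ * _); apply: eq_bigr => i _; rewrite mxE rmorphXn.
Qed.

Lemma grad_map (S : fieldType) (phi : {rmorphism R -> S}) m (x : 'rV[R]_m)
    (p : {mpoly R[m]}) :
  grad phi p (map_mx phi x) = map_mx phi (grad idfun p x).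
Proof. by apply/rowP => i; rewrite !mxE mmap_map. Qed.

(* Its roots t are the points at which (u, t) is an eigenvector of the
   perturbed form, when u is a unit eigenvector of h with eigenvalue l. *)
Definition slice_eq (l : R) : {poly R} :=
  sphere_zonal R n d.+2 + e *: ((- l) *: 'X).

Section Slices.
Variables (u : 'rV[R]_n) (l : R).
Hypotheses (unit_u : dot u u = 1) (eigen_u : grad idfun h u = l *: u).

Section Field.
Variables (S : fieldType) (phi : {rmorphism R -> S}) (t : S).
Local Notation ev := (mmap phi (ext (map_mx phi u) t 0)).

Lemma unit_map : \sum_i map_mx phi u 0 i ^+ 2 = 1.
Proof.
rewrite -(rmorph1 phi) -unit_u rmorph_sum; apply: eq_bigr => i _.
by rewrite mxE -rmorphXn expr2.
Qed.

Lemma ev_radial : ev Y = (map_poly phi (radial R n d.+2)).[t].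
Proof. by rewrite -horner_slice slice_radial // unit_map. Qed.

Lemma ev_radial_max : ev Y^`M(ord_max) = (map_poly phi (radial R n d.+2)^`()).[t].
Proof. by rewrite -horner_slice -deriv_slice slice_radial ?deriv_map // unit_map. Qed.

Lemma ev_zonal_max : ev Z^`M(ord_max) = (map_poly phi (zonal R n d.+2)^`()).[t].
Proof. by rewrite -horner_slice -deriv_slice slice_zonal ?deriv_map // unit_map. Qed.

Lemma ev_zonal_max2 :
  ev Z^`M(ord_max)^`M(ord_max) = (map_poly phi (zonal R n d.+2)^`()^`()).[t].
Proof.
by rewrite -horner_slice -!deriv_slice slice_zonal ?deriv_map // unit_map.
Qed.

Lemma horner_slice_eq :
  (map_poly phi (slice_eq l)).[t] = ev Z^`M(ord_max) - t * (ev Y + phi (e * l)).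
Proof.
rewrite ev_zonal_max ev_radial /slice_eq /sphere_zonal.
rewrite !(rmorphD (map_poly phi)) (rmorphN (map_poly phi)) (rmorphM (map_poly phi)) /=.
rewrite !map_polyZ map_polyX !(hornerD, hornerN, hornerM, hornerZ, hornerX).
by rewrite rmorphN rmorphM; ring.
Qed.

Lemma horner_deriv_slice_eq :
  (map_poly phi (slice_eq l)^`()).[t] =
  ev Z^`M(ord_max)^`M(ord_max) - (ev Y + phi (e * l)) - t * ev Y^`M(ord_max).
Proof.
rewrite ev_zonal_max2 ev_radial ev_radial_max /slice_eq /sphere_zonal.
rewrite derivD derivB derivM !derivZ derivX.
rewrite !(rmorphD (map_poly phi), rmorphN (map_poly phi), rmorphM (map_poly phi)) /=.
rewrite !map_polyZ map_polyX rmorph1.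
rewrite !(hornerD, hornerN, hornerM, hornerZ, hornerX, hornerC).
by rewrite rmorphN rmorphM; ring.
Qed.

Lemma grad_slice : grad phi f (ext (map_mx phi u) t) =
  ext ((ev Y + phi (e * l)) *: map_mx phi u) (ev Z^`M(ord_max)).
Proof.
by rewrite grad_step grad_map eigen_u map_mxZ scalerA -scalerDl -rmorphM.
Qed.

Lemma eigen_slice : (map_poly phi (slice_eq l)).[t] = 0 <->
  exists r, grad phi f (ext (map_mx phi u) t) = r *: ext (map_mx phi u) t.
Proof.
rewrite horner_slice_eq grad_slice; split=> [/eqP|[r]].
  rewrite subr_eq0 => /eqP E; exists (ev Y + phi (e * l)).
  by rewrite extZ E [t * _]mulrC.
rewrite extZ => /ext_inj[Eu ->]; suff -> : ev Y + phi (e * l) = r by ring.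
apply/eqP; rewrite -subr_eq0; move/eqP: Eu; rewrite -subr_eq0 -scalerBl scaler_eq0.
by rewrite map_mx_eq0 (negbTE (unit_neq0 unit_u)) orbF.
Qed.

End Field.

(** The x-part of the Hessian equation reduces to that of [h], so [w] is a multiple of [u]. Removing
    a multiple of [(u, t)] leaves [(0, s')]: the x-part now determines [mu'], and the last
    coordinate says that [s'] times the derivative of [slice_eq] is 0. *)
Lemma regular_slice t : h \is d.+2.-homog -> e != 0 -> regular h u ->
  (slice_eq l).[t] = 0 -> (slice_eq l)^`().[t] != 0 -> regular f (ext u t).
Proof.
move=> hh e0 ru q0 q1 m mu v.
have uid : map_mx idfun u = u by apply: map_mx_id.
have := horner_slice_eq idfun t; have := horner_deriv_slice_eq idfun t.
have := grad_slice idfun t.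
rewrite uid !map_poly_id // q0 => gf q1E q0E.
set ev := mmap idfun _ in gf q0E q1E.
have hf : f \is d.+2.-homog.
  by rewrite rpredD ?dhomog_zonal_mpoly ?rpredZ ?dhomog_mwiden.
have ZT : ev Z^`M(ord_max) = t * (ev Y + e * l) by apply/eqP; rewrite -subr_eq0 -q0E.
rewrite gf extZ => /ext_inj[/eqP]; rewrite -subr_eq0 -scalerBl scaler_eq0.
rewrite (negbTE (unit_neq0 unit_u)) orbF subr_eq0 => /eqP {m} <- _.
set m := ev Y + _ in q1E *.
have gm : grad idfun f (ext u t) = m *: ext u t by rewrite gf extZ ZT [t * _]mulrC.
have [w [s ->]] : exists w s, v = ext w s by do 2!eexists; apply: ext_surj.
move=> hv.
have [a wE] : exists a, w = a *: u.
  apply/sub_rVP.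
  have := hv; rewrite hess_step -/ev !extZ extD => /ext_inj[+ _].
  set k := ev Y2 * _ + _ => E; apply: (ru l ((mu - k) / e) w eigen_u).
  apply: (scalerI e0); rewrite scalerDr !scalerA [e * ((mu - k) / e)]mulrC divfK //.
  apply: (addrI (ev Y *: w + k *: u)); rewrite E /m.
  by apply/rowP => i; rewrite !mxE /= /idfun; ring.
have vE : ext w s = a *: ext u t + ext 0 (s - a * t).
  by rewrite extZ extD -wE addr0 addrC subrK.
set s' := s - a * t in vE.
(* The Hessian multiplies [(u, t)] by [(d + 1) m], so removing [a (u, t)] from [v] changes only the
   coefficient [mu]. *)
pose mu' := mu - a * (d.+1%:R * m) + a * m.
have : ext 0 s' *m hess f (ext u t) = m *: ext 0 s' + mu' *: ext u t.
  have -> : ext 0 s' = ext w s - a *: ext u t by rewrite vE addrC addKr.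
  rewrite mulmxBl hv -scalemxAl (hess_euler _ hf) gm /mu'.
  move: (ext u t) (ext w s) => x y.
  by apply/rowP => i; rewrite !mxE; ring.
rewrite hess_step -/ev !extZ extD => /ext_inj[].
rewrite mul0mx !scaler0 !addr0 add0r.
have -> : dot u 0 = 0 by rewrite /dot big1 // => i _; rewrite mxE mulr0.
rewrite mulr0 mul0r !add0r => /eqP; rewrite -subr_eq0 -scalerBl scaler_eq0.
rewrite (negbTE (unit_neq0 unit_u)) orbF subr_eq0 => /eqP <- E.
have : s' * (slice_eq l)^`().[t] = 0.
  rewrite q1E -/m !mulrBr E; ring.
move/eqP; rewrite mulf_eq0 (negbTE q1) orbF => /eqP s0.
by rewrite vE s0 ext0 addr0 scalemx_sub.
Qed.

End Slices.

Section Pole.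
Hypothesis hom_h : h \is d.+2.-homog.

Lemma dhomog_step : f \is d.+2.-homog.
Proof. by rewrite rpredD ?dhomog_zonal_mpoly ?rpredZ ?dhomog_mwiden. Qed.

Lemma ext0_sqnorm (S : fieldType) (phi : {rmorphism R -> S}) :
  mmap phi (ext (0 : 'rV_n) 1 0) (sqnorm R n) = 0.
Proof.
rewrite raddf_sum big1 // => i _.
by rewrite /= rmorphXn /= mmapX mmap1U ext_widen mxE expr0n.
Qed.

Lemma pole_monomial (S : fieldType) (phi : {rmorphism R -> S}) a b :
  mmap phi (ext (0 : 'rV_n) 1 0) ('X_ord_max ^+ a * sqnorm R n ^+ b) = (b == 0%N)%:R.
Proof. by rewrite rmorphM !rmorphXn /= ext0_sqnorm mmapX mmap1U ext_max expr1n mul1r expr0n. Qed.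

Lemma mmap_sumE (S : fieldType) (phi : {rmorphism R -> S}) z m (F : 'I_m -> {mpoly R[n.+1]}) :
  mmap phi z (\sum_i F i) = \sum_i mmap phi z (F i).
Proof. exact: raddf_sum. Qed.

Lemma pole_eigen (S : fieldType) (phi : {rmorphism R -> S}) :
  grad phi f (ext 0 1) = mmap phi (ext 0 1 0) Z^`M(ord_max) *: ext 0 1.
Proof.
have g0 : grad phi h 0 = 0.
  by rewrite -{1}(scale0r 0) (gradZ _ _ _ hom_h) expr0n scale0r.
by rewrite grad_step g0 !scaler0 addr0 extZ scaler0 mulr1.
Qed.

Local Notation ev := (mmap idfun (ext (0 : 'rV[R]_n) 1 0)).

Lemma pole_zonal : ev Z^`M(ord_max) = d.+2%:R.
Proof.
have := congr1 (mmap idfun (ext (0 : 'rV[R]_n) 1 0)) (mpoly_euler (dhomog_zonal_mpoly R n_gt0 d.+2)).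
rewrite big_ord_recr /= raddfD raddf_sum big1 => [|i _]; last first.
  by rewrite /= rmorphM /= mmapX mmap1U ext_widen mxE mul0r.
rewrite /= add0r rmorphM /= mmapX mmap1U ext_max mul1r mmapMn => ->.
rewrite /zonal_mpoly mmap_sumE big_ord_recl big1 ?addr0 => [|i _].
  by rewrite mmapZ pole_monomial mulr1 /zonal_coef mulr1 ffactn0.
by rewrite mmapZ pole_monomial mulr0.
Qed.

Lemma pole_radial : ev Y <= 0.
Proof.
rewrite /radial_mpoly mmap_sumE big_ord_recl big_ord_recl big1 ?addr0 => [|i _].
  rewrite !mmapZ !pole_monomial mul0r mul0r add0r mulr1 /zonal_coef.
  rewrite mulr_ge0_le0 ?ler0n // mulr_ge0_le0 ?ler0n //=.
  by rewrite mulN1r oppr_le0 invr_ge0 ler0n.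
by rewrite mmapZ pole_monomial mulr0.
Qed.

(** The eigenvalue at the pole is [d + 2], whereas the zonal Hessian acts on the x-part by [Y <= 0],
    a gap of at least 2. The Hessian of [h] at 0 enters only when [h] is quadratic, and then
    [e * r < 1] cannot close the gap. *)
Lemma regular_pole : e != 0 ->
  (forall w r, d = 0%N -> w != 0 -> grad idfun h w = r *: w -> e * r < 1) ->
  regular f (ext 0 1).
Proof.
move=> e0 small m mu v.
rewrite pole_eigen pole_zonal !extZ => /ext_inj[_]; rewrite !mulr1 => <-.
have [w [s ->]] : exists w s, v = ext w s by do 2!eexists; apply: ext_surj.
rewrite hess_step !extZ extD !scaler0 !addr0 => /ext_inj[+ _].
suff H : w *m hess h 0 = 0 \/ d = 0%N /\ w *m hess h 0 = grad idfun h w.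
  have YZ : ev Y - d.+2%:R < 0.
    by rewrite subr_lt0 (le_lt_trans pole_radial) ?ltr0n.
  move=> E; have {}w0 : w = 0.
    case: H => [|[d0]] H; rewrite H in E.
      rewrite scaler0 addr0 in E; apply/eqP; move/eqP: E.
      rewrite -subr_eq0 -scalerBl scaler_eq0 => /orP[|//].
      by rewrite lt_eqF.
    apply/eqP; apply: contraT => w0.
    have := @small w ((d.+2%:R - ev Y) / e) d0 w0.
    rewrite [e * _]mulrC divfK // => K; suff : d.+2%:R - ev Y < 1.
      by have := pole_radial; have : 2 <= d.+2%:R :> R by [rewrite ler_nat]; lra.
    apply: K; apply: (scalerI e0); rewrite scalerA [e * _]mulrC divfK // scalerBl -E.
    by rewrite addrC addKr.
  by apply/sub_rVP; exists s; rewrite w0 extZ scaler0 mulr1.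
have hz : hess h 0 = 0 ^+ d *: hess h w by rewrite -(hessZ _ _ hom_h) scale0r.
case: (posnP d) => [d0|d0]; [right|left]; rewrite hz.
  by split=> //; rewrite d0 expr0 scale1r (hess_euler _ hom_h) d0 scale1r.
by rewrite expr0n gtn_eqF // scale0r mulmx0.
Qed.

End Pole.

End Step.

Section StepTheorem.
Variables (R : realType) (n d : nat).
Hypothesis n_gt0 : (0 < n)%N.
Local Notation toC := (real_complex R).
Variables (h : {mpoly R[n]}) (s : seq 'rV[R]_n).
Hypotheses (hom_h : h \is d.+2.-homog) (conf : real_configuration h s).

Definition eigenvalue_at (u : 'rV[R]_n) : R := dot u (grad idfun h u).
Local Notation lam := eigenvalue_at.

Lemma eigenvalue_atP u : u \in s -> grad idfun h u = lam u *: u.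
Proof.
case: conf => _ _ sP _ /sP[u1 [l gu] _].
by rewrite /lam gu -{2}(scale1r u) dotZ mul1r u1 mulr1.
Qed.

Definition good_parameter (e : R) := [/\ e != 0,
  {in s, forall u, exists2 r, size r = d.+1 & simply_split (slice_eq n d e (lam u)) r} &
  {in s, forall u, e * lam u < 1}].

Lemma good_parameter_ex : exists e, good_parameter e.
Proof.
have [s0 hs0] := sphere_zonal_split R n_gt0 d.
have sz0 := size_sphere_zonal R n_gt0 d.+1.
have sz : size s0 = d.+1 by apply/eqP; rewrite -eqSS -(size_simply_split hs0) sz0.
have H1 : eventually_small (fun e => {in s, forall u,
    exists2 r, size r = d.+1 & simply_split (slice_eq n d e (lam u)) r}).
  apply: eventually_small_all => u us; rewrite -sz.
  apply: simply_split_perturb; rewrite ?sz0 //.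
  by rewrite (leq_trans (size_scale_leq _ _)) // size_polyX.
have H2 : eventually_small (fun e => {in s, forall u, `|e * lam u| < 1}).
  apply: eventually_small_all => u us; apply: eventually_small_mulr_lt; exact: ltr01.
have [e e0 [K1 K2]] := eventually_small_ex (eventually_small_and H1 H2).
exists e; split=> //; first by rewrite gt_eqF.
by move=> u us; apply: le_lt_trans (ler_norm _) (K2 u us).
Qed.

Variable e : R.
Hypothesis good : good_parameter e.
Local Notation f := (step_mpoly d h e).

(** For a quadratic form the eigenvalue does not change when the eigenvector is rescaled, so
    completeness of the configuration extends the bound from [s] to every real eigenvector. *)
Lemma step_eigenvalue_lt1 w r : d = 0%N -> w != 0 -> grad idfun h w = r *: w -> e * r < 1.
Proof.
move=> d0 w0 gw; have [_ _ _ compl] := conf.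
have [||u us] := compl (map_mx toC w).
- by rewrite map_mx_eq0.
- by exists (toC r); rewrite grad_map gw map_mxZ.
rewrite map_submx => /sub_rVP[a wu].
have a0 : a != 0 by apply: contraNneq w0 => a0; rewrite wu a0 scale0r.
have [_ _ small] := good.
have u0 : u != 0 by have [_ _ sP _] := conf; have [u1 _ _] := sP u us; apply: unit_neq0 u1.
have := gw; rewrite wu (gradZ _ _ _ hom_h) d0 expr1 (eigenvalue_atP us) !scalerA.
move=> /eqP; rewrite -subr_eq0 -scalerBl scaler_eq0 (negbTE u0) orbF.
rewrite subr_eq0 mulrC => /eqP/(mulIf a0) <-; exact: small.
Qed.

Lemma step_roots : {rts : 'rV[R]_n -> seq R | {in s, forall u,
  size (rts u) = d.+1 /\ simply_split (slice_eq n d e (lam u)) (rts u)}}.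
Proof.
have [_ H _] := good.
have [u|g gP] := @boolp.choice _ _ (fun (u : 'rV[R]_n) r => u \in s ->
   size r = d.+1 /\ simply_split (slice_eq n d e (lam u)) r).
  case: (boolP (u \in s)) => [/H [r rs rq]|us]; first by exists r.
  by exists [::].
by exists g => u; apply: gP.
Qed.

Lemma step_configuration : exists s', 
  size s' = (1 + d.+1 * size s)%N /\ real_configuration f s'.
Proof.
have [rts rtsP] := step_roots.
have [us prop sP compl] := conf.
pose s' := [seq ext u t | u <- s, t <- rts u].
have s'P z : z \in s' -> exists u t, [/\ u \in s, t \in rts u & z = ext u t].
  by move/allpairsPdep => [u [t]]; exists u, t.
have u0 u : u \in s -> u != 0 by move=> /sP[u1 _ _]; apply: unit_neq0 u1.
have hf := dhomog_step n_gt0 e hom_h.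
exists (map (@normalize R n.+1) (ext 0 1 :: s')); split.
  rewrite size_map /= size_allpairs_dep add1n; congr _.+1.
  rewrite sumnE big_map big_seq (eq_bigr (fun=> d.+1)) => [|u /rtsP[]//].
  by rewrite -big_seq big_const_seq count_predT iter_addn_0.
apply: (real_configuration_normalize hf).
- rewrite cons_uniq; apply/andP; split.
    apply/negP => /s'P[u [t [us' _ /ext_inj[E _]]]].
    by have := u0 _ us'; rewrite -E eqxx.
  apply: allpairs_uniq_dep => //.
    by move=> u /rtsP[_ []].
  by move=> [u t] [u' t'] _ _ /ext_inj[/= -> ->].
- move=> x y; rewrite !inE => /orP[/eqP->|/s'P[u [t [us1 tu ->]]]].
    case/orP=> [/eqP->//|/s'P[u' [t' [us2 _ ->]]]] /sub_rVP[a].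
    rewrite extZ => /ext_inj[/esym/eqP]; rewrite scaler_eq0 (negbTE (u0 _ us2)) orbF.
    by move=> /eqP -> /eqP; rewrite mul0r oner_eq0.
  case/orP=> [/eqP->|/s'P[u' [t' [us2 _ ->]]]] /sub_rVP[a].
    by rewrite extZ scaler0 => /ext_inj[E]; have := u0 _ us1; rewrite E eqxx.
  rewrite extZ => /ext_inj[E ->].
  have E' : u = u' by apply: prop => //; rewrite E scalemx_sub.
  move: E; rewrite -{}E' => /eqP; rewrite -{1}(scale1r u) -subr_eq0 -scalerBl scaler_eq0.
  by rewrite (negbTE (u0 _ us1)) orbF subr_eq0 => /eqP <-; rewrite mul1r.
- have [e0 _ _] := good.
  move=> x; rewrite inE => /orP[/eqP->|/s'P[u [t [us1 tu ->]]]].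
    split.
    + by rewrite -ext0; apply/eqP => /ext_inj[_ /eqP]; rewrite oner_eq0.
    + by eexists; apply: pole_eigen.
    + by apply: regular_pole => // w r; apply: step_eigenvalue_lt1.
  have [u1 _ ru] := sP u us1; have gu := eigenvalue_atP us1.
  have [_ sq] := rtsP u us1.
  have q0 : (slice_eq n d e (lam u)).[t] = 0.
    by apply/eqP; rewrite -rootE (simply_split_mem _ sq).
  split.
  + by rewrite -ext0; apply/eqP => /ext_inj[E]; have := u0 _ us1; rewrite E eqxx.
  + have [K _] := eigen_slice d e u1 gu idfun t.
    by move: K; rewrite map_poly_id // (map_mx_id (f := idfun)) //; apply.
  + by apply: (regular_slice _ u1 gu) => //; apply: simply_split_deriv sq tu.
- move=> z z0 [l]; have [w [t zE]] : exists w t, z = ext w t.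
    by do 2!eexists; apply: ext_surj.
  rewrite {}zE in z0 *.
  (* Completeness over the complex numbers: a vector on the axis is a multiple of the pole;
     otherwise [w] is an eigenvector of [h], hence [c] times some [u] of [s], and [t / c] is a
     complex root of [slice_eq], which splits over the reals. *)
  have [->|w0] := eqVneq w 0.
    move=> _; exists (ext 0 1); first exact: mem_head.
    by apply/sub_rVP; exists t; rewrite map_ext extZ map_mx0 scaler0 rmorph1 mulr1.
  move=> /[dup] E0; rewrite grad_step extZ => /ext_inj[E _].
  have [e0 _ _] := good.
  have [|u us1] := compl w w0.
    exists ((l - mmap toC (ext w t 0) (radial_mpoly R n d.+2)) / toC e).
    have e1 : toC e != 0 by rewrite fmorph_eq0.
    apply: (scalerI e1); rewrite scalerA mulrC divfK // scalerBl -E.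
    by rewrite addrC addKr.
  move=> /sub_rVP[c wu].
  have c0 : c != 0 by apply: contraNneq w0 => c0; rewrite wu c0 scale0r.
  have zu : ext w t = c *: ext (map_mx toC u) (t / c).
    by rewrite extZ -wu mulrC divfK.
  have [u1 _ _] := sP u us1; have gu := eigenvalue_atP us1.
  have [_ sq] := rtsP u us1.
  have : exists l', grad toC f (ext (map_mx toC u) (t / c)) = l' *: ext (map_mx toC u) (t / c).
    have ci : c^-1 != 0 by rewrite invr_eq0.
    by have := eigen_scale hf ci E0; rewrite zu scalerA mulVf // scale1r.
  move/(eigen_slice d e u1 gu)/eqP; rewrite -rootE; have [_ [k k0 ->]] := sq.
  rewrite map_polyZ rootZ ?fmorph_eq0 // rmorph_prod /=.
  rewrite (eq_bigr (fun x => 'X - (toC x)%:P)) => [|x _]; last by rewrite map_polyXsubC.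
  rewrite -(big_map toC xpredT (fun y => 'X - y%:P)) root_prod_XsubC => /mapP[x xr tx].
  exists (ext u x); last by rewrite zu map_ext tx scalemx_sub.
  by rewrite inE; apply/orP; right; apply/allpairsPdep; exists u, x.
Qed.

End StepTheorem.

(** * Base cases and induction on the number of variables *)

Section Existence.
Variable R : realType.
Local Notation toC := (real_complex R).

Lemma harmonic_step n d (h : {mpoly R[n]}) e : (0 < n)%N -> harmonic h ->
  harmonic (step_mpoly d h e).
Proof.
move=> n0 hh; rewrite /harmonic /step_mpoly.
under eq_bigr => i _ do rewrite !mderivD !mderivZ.
rewrite big_split /= harmonic_zonal_mpoly // add0r -scaler_sumr big_ord_recr /=.
rewrite mderiv_mwiden_max mderiv0 addr0.
under eq_bigr => i _ do rewrite !mderiv_mwiden.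
by rewrite -raddf_sum /= [X in mwiden X]hh mwiden0 scaler0.
Qed.

Lemma expected_numberS d n :
  expected_number d n.+1 = (1 + d.-1 * expected_number d n)%N.
Proof.
rewrite /expected_number big_ord_recl expn0 big_distrr /=; congr (_ + _)%N.
by apply: eq_bigr => i _; rewrite -expnS.
Qed.

(** In one variable 0 is the only harmonic form of degree at least 2, so the induction has to start
    from it; non-degeneracy holds because all vectors are multiples of one. *)
Lemma real_configuration1 (f : {mpoly R[1]}) : f = 0 ->
  real_configuration f [:: const_mx 1].
Proof.
have sub1 (F : fieldType) (v : 'rV[F]_1) : (v <= (const_mx 1 : 'rV[F]_1))%MS.
  by apply/sub_rVP; exists (v 0 0); apply/rowP => i; rewrite ord1 !mxE mulr1.
move=> ->; split=> //.
- by move=> x y; rewrite !inE => /eqP-> /eqP->.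
- move=> x; rewrite inE => /eqP->; split.
  + by rewrite /dot big_ord1 mxE mulr1.
  + by exists 0; rewrite scale0r; apply/rowP => i; rewrite !mxE mderiv0 mmap0.
  + by move=> *; apply: sub1.
- move=> z _ _; exists (const_mx 1); first exact: mem_head.
  by rewrite map_const_mx rmorph1.
Qed.

(** Degree 1, which the zonal step does not reach. The gradient is constant and the Hessian 0, so
    the equation of [regular] reads [0 = v + mu x]. *)
Lemma real_configuration_var n : real_configuration ('X_0 : {mpoly R[n.+1]}) [:: delta_mx 0 0].
Proof.
have gX (S : fieldType) (phi : {rmorphism R -> S}) z :
    grad phi ('X_0 : {mpoly R[n.+1]}) z = delta_mx 0 0.
  by apply/rowP => i; rewrite !mxE mderivXU rmorph_nat.
have d0 (F : fieldType) : delta_mx 0 0 != 0 :> 'rV[F]_n.+1.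
  by apply/eqP => /rowP/(_ 0); rewrite !mxE => /eqP; rewrite oner_eq0.
split=> //.
- by move=> x y; rewrite !inE => /eqP-> /eqP->.
- move=> x; rewrite inE => /eqP->; split.
  + rewrite /dot (bigD1 0) //= big1 => [|i i0]; rewrite !mxE ?eqxx ?mulr1 ?addr0 //.
    by rewrite (negbTE i0) mulr0.
  + by exists 1; rewrite gX scale1r.
  + move=> l mu v; rewrite gX => /eqP; rewrite -[X in X == _](scale1r) -subr_eq0.
    rewrite -scalerBl scaler_eq0 (negbTE (d0 _)) orbF subr_eq0 => /eqP <-.
    have -> : hess ('X_0 : {mpoly R[n.+1]}) (delta_mx 0 0) = 0.
      apply/matrixP => i j; rewrite !mxE mderivXU.
      by rewrite -mpolyC_nat mderivC mmap0.
    rewrite mulmx0 scale1r => /esym/eqP; rewrite addr_eq0 => /eqP ->.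
    by rewrite -scaleNr scalemx_sub.
- move=> z z0 [l]; rewrite gX => lz; exists (delta_mx 0 0); first exact: mem_head.
  rewrite map_delta_mx lz; apply/sub_rVP; exists l^-1; rewrite scalerK //.
  by apply: contraNneq (d0 R[i]) => l0; rewrite lz l0 scale0r.
Qed.

Lemma maximal_configuration n d : (0 < n)%N -> (0 < d)%N ->
  exists f s, [/\ f \is d.-homog, harmonic f, size s = expected_number d n &
    real_configuration (f : {mpoly R[n]}) s].
Proof.
case: d n => [|[|d]] [|n] // _ _.
  exists 'X_0, [:: delta_mx 0 0]; split; last exact: real_configuration_var.
  - exact: dhomog_var.
  - rewrite /harmonic big1 // => i _.
    by rewrite mderivXU -mpolyC_nat mderivC.
  - by rewrite expected_numberS mul0n.
elim: n => [|n [h [s [hh harm sz conf]]]].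
  exists 0, [:: const_mx 1]; split; rewrite ?dhomog0 //.
  - by rewrite /harmonic big1 // => i _; rewrite !mderiv0.
  - by rewrite /expected_number big_ord1.
  - exact: real_configuration1.
have [e good] := good_parameter_ex d (isT : 0 < n.+1)%N h s.
have [s' [sz' conf']] := step_configuration (isT : 0 < n.+1)%N hh conf good.
exists (step_mpoly d h e), s'; split=> //.
- exact: dhomog_step.
- exact: harmonic_step.
- by rewrite sz' sz [RHS]expected_numberS.
Qed.

End Existence.

(** * Symmetric tensors of forms *)

Section Tensors.
Variables (R : realType) (n : nat).
Local Notation toC := (real_complex R).
Implicit Types (f g : {mpoly R[n]}).

(** Polarization: [d] derivatives of a form of degree [d] leave a constant, read off as the
    coefficient at 0, and [1 / d!] makes the tensor represent that form. *)
Definition tensor_of d f : tensor R n d :=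
  [ffun t : d.-tuple 'I_n => (foldr (@mderiv n R) f t)@_0%MM / d`!%:R].

Lemma entry_tensor_of d f u : size u = d ->
  entry (tensor_of d f) u = (foldr (@mderiv n R) f u)@_0%MM / d`!%:R.
Proof.
by move=> su; rewrite /entry; case: insubP => [t _ <-|]; rewrite ?ffunE // su eqxx.
Qed.

Lemma entry_size (F : fieldType) d (A : tensor F n d) u : size u != d -> entry A u = 0.
Proof. by move=> su; rewrite /entry insubF // (negbTE su). Qed.

Lemma entry_complexify d (A : tensor R n d) u : entry (complexify A) u = toC (entry A u).
Proof. by rewrite /entry; case: insub => [t|]; rewrite ?ffunE ?rmorph0. Qed.

Lemma tensor_of_symmetric d f : tensor_symmetric (tensor_of d f).
Proof.
move=> s t; rewrite !ffunE; congr (_@__ / _); apply: mderiv_perm.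
by apply/tuple_permP; exists s.
Qed.

Lemma foldr_mderiv_sum (I : Type) (r : seq I) (F : I -> {mpoly R[n]}) u :
  foldr (@mderiv n R) (\sum_(i <- r) F i) u = \sum_(i <- r) foldr (@mderiv n R) (F i) u.
Proof. by elim: u => //= j u ->; rewrite mderiv_sumE. Qed.

Lemma tensor_of_traceless d f : harmonic f -> traceless (tensor_of d f).
Proof.
move=> hf u; have [su|su] := eqVneq (size u).+2 d; last first.
  by rewrite big1 // => i _; rewrite entry_size.
under eq_bigr => i _.
  rewrite entry_tensor_of //.
  (* The repeated index moves to the end, where [foldr] differentiates first; the trace becomes a
     derivative of the Laplacian. *)
  rewrite (@mderiv_perm _ _ _ (u ++ [:: i; i])); last by rewrite (perm_catC [:: i; i] u).
  rewrite foldr_cat /=; over.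
rewrite -mulr_suml -raddf_sum /= -foldr_mderiv_sum [X in foldr _ X _]hf.
suff -> : foldr (@mderiv n R) 0 u = 0 by rewrite mcoeff0 mul0r.
by elim: (u) => //= j v ->; rewrite mderiv0.
Qed.

Lemma sum_cons_tuple (V : nmodType) m (F : m.+1.-tuple 'I_n -> V) :
  \sum_t F t = \sum_i \sum_(t : m.-tuple 'I_n) F [tuple of i :: t].
Proof.
rewrite pair_big /= (reindex (fun p : 'I_n * m.-tuple 'I_n => [tuple of p.1 :: p.2])) //=.
exists (fun t => (thead t, [tuple of behead t])) => [[i t] _|t _] /=.
  by congr (_, _); apply: val_inj.
by case/tupleP: t => i t; apply: val_inj.
Qed.

(** Euler's identity iterated [m] times; the successive degrees multiply to [m!]. *)
Lemma taylor_homog (S : fieldType) (phi : {rmorphism R -> S}) (z : 'I_n -> S) m g :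
  g \is m.-homog ->
  \sum_(t : m.-tuple 'I_n) phi (foldr (@mderiv n R) g t)@_0%MM * \prod_(j <- t) z j =
  m`!%:R * mmap phi z g.
Proof.
elim: m g => [|m IH] g hg.
  rewrite (big_pred1 [tuple]) => [|t]; last by symmetry; apply/eqP; exact: tuple0.
  rewrite /= big_nil mulr1 mul1r.
  have -> : g = (g@_0%MM)%:MP.
    apply/mpolyP => k; rewrite mcoeffC; case: eqVneq => [->|k0]; first by rewrite mulr1.
    by rewrite mulr0 (dhomog_nemf_coeff hg) //= mdeg_eq0.
  by rewrite mmapC mcoeffC eqxx mulr1.
rewrite sum_cons_tuple.
under eq_bigr => i _.
  under eq_bigr => t _.
    rewrite (@mderiv_perm _ _ _ (t ++ [:: i])); last by rewrite perm_sym perm_catC perm_refl.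
    rewrite foldr_cat /= big_cons mulrCA; over.
  rewrite -mulr_sumr (IH _ (dhomog_mderiv i hg)) mulrCA; over.
have E : \sum_i z i * mmap phi z g^`M(i) = m.+1%:R * mmap phi z g.
  have := congr1 (mmap phi z) (mpoly_euler hg).
  rewrite mmapMn mulr_natl => <-; rewrite raddf_sum.
  by apply: eq_bigr => i _; rewrite /= rmorphM /= mmapX mmap1U.
by rewrite -mulr_sumr E factS natrM; ring.
Qed.

Lemma tensor_apply_complexify d f z : f \is d.+1.-homog ->
  tensor_apply (complexify (tensor_of d.+1 f)) z = (d.+1%:R)^-1 *: grad toC f z.
Proof.
move=> hf; apply/rowP => i; rewrite !mxE.
have H := taylor_homog toC (z 0) (dhomog_mderiv i hf).
transitivity ((d.+1`!%:R)^-1 * (d`!%:R * mmap toC (z 0) f^`M(i))).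
  rewrite -H mulr_sumr; apply: eq_bigr => t _.
  rewrite entry_complexify entry_tensor_of ?size_tuple //.
  rewrite (@mderiv_perm _ _ _ (t ++ [:: i])); last by rewrite perm_sym perm_catC perm_refl.
  by rewrite foldr_cat /= fmorph_div rmorph_nat; ring.
rewrite mulrA; congr (_ * _); rewrite factS natrM.
have d0 : d`!%:R != 0 :> R[i] by rewrite pnatr_eq0 -lt0n fact_gt0.
by rewrite invfM mulfVK.
Qed.

Lemma eigenvector_complexify d f z : f \is d.+1.-homog ->
  eigenvector (complexify (tensor_of d.+1 f)) z <->
  z != 0 /\ exists l, grad toC f z = l *: z.
Proof.
move=> hf; have d0 : d.+1%:R != 0 :> R[i] by rewrite pnatr_eq0.
split=> -[z0 [l hl]]; split=> //.
  exists (d.+1%:R * l); move: hl; rewrite tensor_apply_complexify // => hl.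
  by rewrite -scalerA -hl scalerA divff // scale1r.
by exists (d.+1%:R^-1 * l); rewrite tensor_apply_complexify // hl scalerA.
Qed.

Lemma vline_eqP (F : fieldType) (x y : 'rV[F]_n) : x != 0 ->
  (x <= y)%MS -> <[x]>%VS = <[y]>%VS.
Proof.
move=> x0 /sub_rVP[a xE]; have a0 : a != 0.
  by apply: contraNneq x0 => a0; rewrite xE a0 scale0r.
apply/eqP; rewrite eqEsubv -!memvE; apply/andP; split.
  by rewrite xE memvZ ?memv_line.
by rewrite -(scalerK a0 y) -xE memvZ ?memv_line.
Qed.

Lemma real_configuration_eigenpoints d f s : f \is d.+1.-homog ->
  real_configuration f s ->
  number_of (eigenpoint (complexify (tensor_of d.+1 f))) (size s) /\
  forall p, eigenpoint (complexify (tensor_of d.+1 f)) p -> real_point p.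
Proof.
move=> hf [us prop sP compl].
have s0 x : x \in s -> x != 0 by move=> /sP[x1 _ _]; apply: unit_neq0 x1.
have eigenP p : eigenpoint (complexify (tensor_of d.+1 f)) p <->
    exists2 x, x \in s & p = <[map_mx toC x]>%VS.
  split=> [[z /(eigenvector_complexify _ hf)[z0 /(compl z z0) [x xs zx]] ->]|[x xs ->]].
    by exists x => //; apply: vline_eqP.
  exists (map_mx toC x) => //; apply/(eigenvector_complexify _ hf).
  rewrite map_mx_eq0 s0 //; split=> //; have [_ [l gx] _] := sP x xs.
  by exists (toC l); rewrite grad_map gx map_mxZ.
split; last first.
  by move=> p /eigenP[x xs ->]; exists x => //; apply: s0.
exists [seq <[map_mx toC x]>%VS | x <- s]; split; last 2 first.
- by rewrite size_map.
- move=> p; split=> [/mapP[x xs ->]|/eigenP[x xs ->]]; last exact: map_f.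
  by apply/eigenP; exists x.
rewrite map_inj_in_uniq // => x y xs ys E; apply: prop => //.
have : map_mx toC x \in <[map_mx toC y]>%VS by rewrite -E memv_line.
case/vlineP => a xy; rewrite -(map_submx toC); apply/sub_rVP; by exists a.
Qed.

End Tensors.

(** * Critical points on the sphere *)

Section SphereCritical.
Variables (R : realType) (n d : nat) (f : {mpoly R[n]}).
Hypothesis hom_f : f \is d.+1.-homog.
Local Notation toC := (real_complex R).
Implicit Types (x v w : 'rV[R]_n).

Lemma dotC x v : dot x v = dot v x.
Proof. by apply: eq_bigr => i _; rewrite mulrC. Qed.

Lemma dotDr x v w : dot x (v + w) = dot x v + dot x w.
Proof. by rewrite /dot -big_split; apply: eq_bigr => i _; rewrite mxE mulrDr. Qed.

Lemma dotZr a x v : dot x (a *: v) = a * dot x v.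
Proof. by rewrite -{1}(scale1r x) dotZ mul1r. Qed.

Lemma dotBr x v w : dot x (v - w) = dot x v - dot x w.
Proof. by rewrite -scaleN1r dotDr dotZr mulN1r. Qed.

Lemma orthogonal_complement x p : dot x x = 1 ->
  (forall w, dot x w = 0 -> dot p w = 0) -> p = dot x p *: x.
Proof.
move=> x1 H; apply/eqP; rewrite -subr_eq0 -dot_eq0.
set q := p - _; have xq : dot x q = 0 by rewrite dotBr dotZr x1 mulr1 subrr.
rewrite {1}/q dotC dotBr dotZr [dot q p]dotC [dot q x]dotC xq mulr0 subr0.
by rewrite H.
Qed.

Lemma sphere_criticalP x : sphere_critical f x <->
  dot x x = 1 /\ exists l, grad idfun f x = l *: x.
Proof.
have gE v : \sum_(i < n) (f^`M(i)).@[x 0] * v 0 i = dot (grad idfun f x) v.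
  by apply: eq_bigr => i _; rewrite mxE.
split=> -[x1 H]; split=> //.
  by eexists; apply: orthogonal_complement x1 _ => w /H; rewrite gE.
by case: H => l gx v xv; rewrite gE gx dotC dotZr dotC xv mulr0.
Qed.

(** Euler's identity replaces [<y, grad f>] by [(d + 1) f], which is [l] at [x]. Differentiating its
    product with [y] along [v] gives [(d + 1) l <x, v> x + l v], whose first term is 0. *)
Lemma sphere_hessianE x l v w : dot x x = 1 -> grad idfun f x = l *: x ->
  dot x v = 0 -> dot x w = 0 ->
  sphere_hessian f x v w = dot (v *m hess f x - l *: v) w.
Proof.
move=> x1 gx xv xw.
have g i : mmap idfun (x 0) f^`M(i) = l * x 0 i.
  by move/rowP/(_ i): gx; rewrite !mxE.
have fE : mmap idfun (x 0) f *+ d.+1 = l.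
  have := congr1 (mmap idfun (x 0)) (mpoly_euler hom_f).
  rewrite mmapMn => <-; rewrite raddf_sum -[RHS]mulr1 -x1 mulr_sumr.
  by apply: eq_bigr => i _; rewrite /= rmorphM /= mmapX mmap1U g; ring.
have term i j : ((sphere_grad f i)^`M(j)).@[x 0] =
    hess f x j i - (d.+1%:R * l * x 0 j * x 0 i + l * (i == j)%:R).
  rewrite /sphere_grad (mpoly_euler hom_f) mderivB mderivM mderivXU mderivMn mxE.
  rewrite /meval mmapB mmapD !rmorphM /= mmapX mmap1U rmorph_nat !mmapMn g.
  by rewrite mderiv_comm fE eq_sym; ring.
rewrite /sphere_hessian; transitivity (\sum_i ((v *m hess f x) 0 i -
    d.+1%:R * l * dot x v * x 0 i - l * v 0 i) * w 0 i).
  apply: eq_bigr => i _; rewrite -mulr_suml; congr (_ * _).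
  rewrite (eq_bigr (fun j => v 0 j * hess f x j i -
     d.+1%:R * l * x 0 i * (x 0 j * v 0 j) - l * ((i == j)%:R * v 0 j))); last first.
    by move=> j _; rewrite term; ring.
  rewrite !sumrB -!mulr_sumr -/(dot x v) mxE [in RHS]mulrAC; congr (_ - _ - _ * _).
  rewrite (bigD1 i) //= eqxx mul1r big1 ?addr0 // => j ji.
  by rewrite eq_sym (negbTE ji) mul0r.
by rewrite xv; apply: eq_bigr => i _; rewrite !mxE; ring.
Qed.

(** If [v] satisfies the equation of [regular], its tangential part lies in the kernel of the
    Riemannian Hessian. Conversely, for [v] in that kernel, [v *m hess f x - l *: v] is orthogonal
    to the tangent space, hence a multiple of [x]. *)
Lemma sphere_morseP : sphere_morse f <->
  forall x, sphere_critical f x -> regular f x.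
Proof.
split=> [morse x cx l mu v gx hv|H x cx v xv hw].
  have [x1 _] := (sphere_criticalP x).1 cx.
  pose v' := v - dot x v *: x.
  have xv' : dot x v' = 0 by rewrite dotBr dotZr x1 mulr1 subrr.
  suff /eqP : v' = 0.
    by rewrite subr_eq0 => /eqP ->; rewrite scalemx_sub.
  apply: (morse x cx v' xv') => w xw; rewrite (sphere_hessianE x1 gx xv' xw).
  have -> : v' *m hess f x - l *: v' = (mu - dot x v * (d%:R * l) + l * dot x v) *: x.
    rewrite mulmxBl hv -scalemxAl (hess_euler _ hom_f) gx.
    by apply/rowP => i; rewrite !mxE; ring.
  by rewrite dotC dotZr [dot w x]dotC xw mulr0.
have [x1 [l gx]] := (sphere_criticalP x).1 cx.
have := H x cx l (dot x (v *m hess f x - l *: v)) v gx.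
rewrite -orthogonal_complement //; last first.
  by move=> w xw; rewrite -(sphere_hessianE x1 gx xv xw) hw.
rewrite addrC subrK => /(_ erefl)/sub_rVP[a va].
by move: xv; rewrite va dotZr x1 mulr1 => ->; rewrite scale0r.
Qed.

Lemma real_configuration_sphere s : real_configuration f s ->
  sphere_morse f /\ number_of (sphere_critical f) (2 * size s).
Proof.
move=> [us prop sP compl].
have crit x : sphere_critical f x <-> x \in s ++ map -%R s.
  split=> [/sphere_criticalP[x1 [l gx]]|].
    have [||u us1] := compl (map_mx toC x).
    - by rewrite map_mx_eq0; apply: unit_neq0 x1.
    - by exists (toC l); rewrite grad_map gx map_mxZ.
    rewrite map_submx => /sub_rVP[a xa]; have [u1 _ _] := sP u us1.
    have : a ^+ 2 = 1 by rewrite -x1 xa dotZ u1 mulr1.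
    move/eqP; rewrite sqrf_eq1 mem_cat => /orP[/eqP a1|/eqP a1].
      by rewrite xa a1 scale1r us1.
    by rewrite xa a1 scaleN1r map_f // orbT.
  rewrite mem_cat => xs; apply/sphere_criticalP; case/orP: xs => [xs|/mapP[u xs ->]].
    by have [] := sP x xs.
  have [u1 [l gu] _] := sP u xs; rewrite -scaleN1r dotZ u1 mulr1 mulrNN mulr1.
  split=> //; have := eigen_scale hom_f (_ : -1 != 0) gu; apply.
  by rewrite oppr_eq0 oner_eq0.
split.
  apply/sphere_morseP => x /crit; rewrite mem_cat => /orP[xs|/mapP[u xs ->]].
    by have [_ _] := sP x xs.
  rewrite -scaleN1r; apply: regularZ hom_f _ _; first by rewrite oppr_eq0 oner_eq0.
  by have [_ _] := sP u xs.
exists (s ++ map -%R s); split; last by move=> x; rewrite crit.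
  rewrite cat_uniq us map_inj_uniq ?us; last exact: oppr_inj.
  rewrite andbT /=; apply/hasPn => _ /mapP[u xs ->]; apply/negP => nxs.
  have E : - u = u by apply: prop; rewrite // -scaleN1r scalemx_sub.
  have [u1 _ _] := sP u xs; have /eqP := unit_neq0 u1; apply.
  apply/rowP => i; move/rowP/(_ i): E; rewrite !mxE => E; lra.
by rewrite size_cat size_map mul2n addnn.
Qed.

End SphereCritical.

(** * A Bezout inequality for non-degenerate zeros *)

Section Counting.

Lemma expn_succ_le x n : ((x.+1) ^ n.+1 <= x ^ n.+1 + n.+1 * x.+1 ^ n)%N.
Proof.
elim: n => [|n IH]; first by rewrite !expn1 expn0 muln1 addn1.
rewrite !(expnS _ n.+1) (expnS x.+1 n) in IH *.
move: (x.+1 ^ n)%N (x ^ n.+1)%N IH => A B IH.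
have := leq_mul (leqnn x) IH; lia.
Qed.

(** If [M > D ^ n], the left side has the larger leading coefficient in [L]; [expn_succ_le] makes a
    violating [L] explicit. *)
Lemma leq_expn_asymptotic M D n c :
  (forall L, M * L ^ n <= (D * L + c) ^ n)%N -> (M <= D ^ n)%N.
Proof.
case: n => [|n] H; first by have := H 0%N; rewrite !expn0 muln1.
rewrite leqNgt; apply/negP => DM.
(* Large enough for [n.+1 * (D * K + 1) ^ n < K ^ n.+1]; taking [L] a multiple of [c.+1] then
   absorbs [c] into [D * K + 1]. *)
pose K := (n.+1 * D.+1 ^ n).+1.
have K0 : (0 < K)%N by [].
have := H (c.+1 * K)%N; apply/negP; rewrite -ltnNge.
apply: (@leq_ltn_trans (c.+1 ^ n.+1 * (D * K).+1 ^ n.+1)).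
  by rewrite -expnMn leq_exp2r //; nia.
rewrite expnMn mulnCA ltn_pmul2l ?expn_gt0 //.
apply: (@leq_ltn_trans ((D * K) ^ n.+1 + n.+1 * (D * K).+1 ^ n)).
  exact: expn_succ_le.
apply: (@leq_trans ((D ^ n.+1).+1 * K ^ n.+1)); last by rewrite leq_mul2r DM orbT.
have -> : ((D ^ n.+1).+1 * K ^ n.+1 = (D * K) ^ n.+1 + K ^ n.+1)%N.
  by rewrite mulSn addnC expnMn.
rewrite ltn_add2l.
apply: (@leq_ltn_trans (n.+1 * (D.+1 * K) ^ n)).
  rewrite leq_mul2l; apply/orP; right; case: n {H DM K0} @K => [|n] K //.
  by rewrite leq_exp2r // mulSn; lia.
by rewrite expnMn expnS mulnA ltn_pmul2r ?expn_gt0.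
Qed.

(** Multiplied by [n!], the binomial of [q + n] is a falling factorial between [q ^ n] and
    [(q + n) ^ n]; this turns [c] into [c + n]. *)
Lemma leq_bin_asymptotic M D n c :
  (forall L, M * 'C(L + n, L) <= 'C(D * L + c + n, D * L + c))%N -> (M <= D ^ n)%N.
Proof.
move=> H; apply: (@leq_expn_asymptotic _ _ _ (c + n)) => L.
have ffact_ge a k : (a ^ k <= (a + k) ^_ k)%N.
  elim: k => [|k IH]; first by rewrite expn0 ffactn0.
  by rewrite addnS ffactnS expnS; apply: leq_mul; rewrite //= leqW // leq_addr.
have ffact_le a k : (a ^_ k <= a ^ k)%N.
  elim: k => [|k IH]; first by rewrite expn0 ffactn0.
  by rewrite ffactnSr expnSr; apply: leq_mul; rewrite // leq_subr.
have binE q : ('C(q + n, q) * n`! = (q + n) ^_ n)%N.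
  by rewrite -bin_ffact -bin_sub ?leq_addr // addKn.
apply: (@leq_trans (M * (L + n) ^_ n)); first by rewrite leq_mul2l ffact_ge orbT.
rewrite -binE mulnA; apply: (@leq_trans ('C(D * L + c + n, D * L + c) * n`!)).
  by rewrite leq_mul2r H orbT.
by rewrite binE addnA.
Qed.

End Counting.

(** * Vanishing polynomial functions and generic functionals *)

Section Vanishing.
Variable K : realFieldType.

Lemma poly_eq0_forall (p : {poly K}) : (forall x, p.[x] = 0) -> p = 0.
Proof.
move=> H; apply/eqP; apply: contraT => p0.
have := @max_poly_roots _ p (map (fun k => k%:R) (iota 0 (size p))) p0.
rewrite size_map size_iota ltnn; apply.
  by apply/allP => x _; rewrite rootE H.
by rewrite map_inj_uniq ?iota_uniq // => a b /eqP; rewrite eqr_nat => /eqP.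
Qed.

Lemma poly_nonroot (p : {poly K}) : p != 0 -> exists x, p.[x] != 0.
Proof.
move=> p0; apply: boolp.contrapT => H; move/eqP: p0; apply.
by apply: poly_eq0_forall => x; apply/eqP/negPn/negP => px; apply: H; exists x.
Qed.

Definition line n (p v : 'I_n -> K) (i : 'I_n) : {poly K} := (p i)%:P + v i *: 'X.

Definition on_line n (p v : 'I_n -> K) (f : {mpoly K[n]}) : {poly K} :=
  mmap (polyC \o idfun) (line p v) f.

Lemma horner_on_line n (p v : 'I_n -> K) f t :
  (on_line p v f).[t] = mmap idfun (fun i => p i + v i * t) f.
Proof.
rewrite /on_line horner_mmap; apply: mmap_ext => i.
by rewrite /line hornerD hornerC hornerZ hornerX.
Qed.

Lemma deriv_on_line n (p v : 'I_n -> K) f :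
  (on_line p v f)^`() = \sum_i v i *: on_line p v f^`M(i).
Proof.
rewrite /on_line deriv_mmap; apply: eq_bigr => i _.
by rewrite /line derivD derivC add0r derivZ derivX alg_polyC mulrC mul_polyC.
Qed.

(** Derivatives along coordinate lines vanish everywhere too, so by induction on the degree all
    partial derivatives are 0; in characteristic 0 the polynomial is then constant. *)
Lemma mpoly_eq0_forall n (f : {mpoly K[n]}) :
  (forall x, mmap idfun x f = 0) -> f = 0.
Proof.
suff H k (g : {mpoly K[n]}) : (forall m, (k <= mdeg m)%N -> g@_m = 0) ->
    (forall x, mmap idfun x g = 0) -> g = 0.
  apply: (H (msize f)) => m hm; apply: memN_msupp_eq0.
  exact: msize_mdeg_ge.
elim: k g => [|k IH] g hg g0; first by apply/mpolyP => m; rewrite mcoeff0 hg.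
have dg i : g^`M(i) = 0.
  apply: IH => [m hm|x].
    by rewrite mcoeff_mderiv hg ?mul0rn // mdegD mdeg1 addn1 ltnS.
  have l0 : on_line x (fun j => (i == j)%:R) g = 0.
    by apply: poly_eq0_forall => t; rewrite horner_on_line g0.
  have := congr1 (horner^~ 0) (deriv_on_line x (fun j => (i == j)%:R) g).
  rewrite l0 deriv0 horner0 horner_sum (bigD1 i) //= big1 => [|j ji]; last first.
    by rewrite eq_sym (negbTE ji) scale0r horner0.
  rewrite addr0 eqxx scale1r horner_on_line => /esym <-.
  by apply: mmap_ext => j; rewrite mulr0 addr0.
have coef m : m != 0%MM -> g@_m = 0.
  move=> m0; have /existsP[i mi] : [exists i, m i != 0%N].
    apply: contraNT m0 => /existsPn H; apply/eqP/mnmP => i; rewrite mnm0E.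
    by apply/eqP/negPn; apply: H.
  have := congr1 (mcoeff (m - U_(i))) (dg i).
  rewrite mcoeff0 mcoeff_mderiv submK ?lep1mP // => /eqP.
  by rewrite mulrn_eq0 /= => /eqP.
have gE : g = (g@_0%MM)%:MP.
  apply/mpolyP => q; rewrite mcoeffC; have [->|q0] := eqVneq q 0%MM.
    by rewrite mulr1.
  by rewrite mulr0 coef.
by rewrite gE; have := g0 (fun=> 0); rewrite {1}gE mmapC /= => ->; rewrite mpolyC0.
Qed.

(** A point of the moment curve: pairing with [(1, r, r ^ 2, ...)] evaluates at [r] the polynomial
    with coefficients [v], and [r] is chosen off the finitely many roots. *)
Lemma row_functional_neq0 m (vs : seq 'rV[K]_m) : {in vs, forall v, v != 0} ->
  exists c : 'rV[K]_m, {in vs, forall v : 'rV[K]_m, \sum_i c 0 i * v 0 i != 0}.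
Proof.
move=> vs0; pose P (v : 'rV[K]_m) : {poly K} := \sum_i v 0 i *: 'X^i.
have P0 v : v \in vs -> P v != 0.
  move=> /vs0; apply: contraNneq => E; apply/eqP/rowP => i; rewrite mxE.
  have := congr1 (fun p : {poly K} => p`_i) E.
  rewrite coef0 coef_sum (bigD1 i) //= coefZ coefXn eqxx mulr1 big1 ?addr0 // => j ji.
  by rewrite coefZ coefXn eq_sym val_eqE (negbTE ji) mulr0.
have [|r] := @poly_nonroot (\prod_(v <- vs) P v).
  by rewrite prodf_seq_neq0; apply/allP => v /P0.
rewrite horner_prod prodf_seq_neq0 => /allP H.
exists (\row_i r ^+ i) => v /H /=; rewrite horner_sum; apply: contraNneq => E.
rewrite -[X in _ == X]E; apply/eqP; apply: eq_bigr => i _.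
by rewrite hornerZ hornerXn mxE mulrC.
Qed.

End Vanishing.

Section Kernel.

Lemma exists_linear_relation (K : fieldType) (I J : finType) (A : I -> J -> K) :
  (#|J| < #|I|)%N ->
  exists2 c : I -> K, exists i, c i != 0 & forall j, \sum_i c i * A i j = 0.
Proof.
move=> JI.
pose M : 'M[K]_(#|I|, #|J|) := \matrix_(i, j) A (enum_val i) (enum_val j).
have /rowV0Pn[v /sub_kermxP vM v0] : kermx M != 0.
  rewrite -mxrank_eq0 mxrank_ker subn_eq0 -ltnNge.
  exact: leq_ltn_trans (rank_leq_col _) JI.
exists (fun i => v 0 (enum_rank i)).
  have /rV0Pn[i vi] := v0; exists (enum_val i); by rewrite enum_valK.
move=> j; transitivity ((v *m M) 0 (enum_rank j)); last by rewrite vM mxE.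
rewrite [RHS]mxE (reindex enum_rank) /=; last by apply: onW_bij; apply: enum_rank_bij.
by apply: eq_bigr => i _; rewrite mxE !enum_rankK.
Qed.

End Kernel.

Section Bezout.
Variables (K : realFieldType) (n D M : nat).
Variables (F : 'I_n -> {mpoly K[n.+1]}) (p : 'I_M -> 'rV[K]_n.+1).
Hypothesis homF : forall i, F i \is D.-homog.
Hypothesis Fp : forall j i, mmap idfun (p j 0) (F i) = 0.
Local Notation widen := (widen_ord (leqnSn n)).

Definition jacobian (j : 'I_M) : 'M[K]_(n.+1, n) :=
  \matrix_(k, i) mmap idfun (p j 0) (F i)^`M(k).

Hypothesis regular_p : forall j (v : 'rV[K]_n.+1), v *m jacobian j = 0 -> (v <= p j)%MS.
Hypothesis p_neq0 : forall j, p j != 0.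
Hypothesis p_inj : forall i j, (p i <= p j)%MS -> i = j.

(** The left kernel lies in a line, so the rank is n: first-order behaviour of the [F i] at a zero
    can be prescribed. *)
Lemma jacobian_surj j (y : 'rV[K]_n) : exists v, v *m jacobian j = y.
Proof.
suff H : row_full (jacobian j).
  by have /submxP[v ->] := submx_full y H; exists v.
rewrite /row_full eqn_leq rank_leq_col /= -ltnS.
have kp : (kermx (jacobian j) <= p j)%MS.
  by apply/row_subP => i; apply: regular_p; rewrite -row_mul mulmx_ker row0.
have := leq_trans (mxrankS kp) (rank_leq_row _).
by rewrite mxrank_ker leq_subLR addn1.
Qed.

Definition linear_form m (c : 'rV[K]_m) : {mpoly K[m]} := \sum_i c 0 i *: 'X_i.

Lemma mmap_linear_form m (c x : 'rV[K]_m) :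
  mmap idfun (x 0) (linear_form c) = \sum_i c 0 i * x 0 i.
Proof.
rewrite raddf_sum; apply: eq_bigr => i _.
by rewrite /= mmapZ mmapX mmap1U.
Qed.

Lemma dhomog_linear_form m (c : 'rV[K]_m) : linear_form c \is 1.-homog.
Proof. by apply: rpred_sum => i _; rewrite rpredZ // dhomogX /= mdeg1. Qed.

(** The ratios at [p i] and [p j] differ when [c1] does not vanish on [h0(p j) p i - h0(p i) p j], a
    nonzero vector because the points are projectively distinct. *)
Lemma separating_forms : exists c0 c1 : 'rV[K]_n.+1,
  let ev c j := mmap idfun (p j 0) (linear_form c) in
  (forall j, ev c0 j != 0) /\ injective (fun j => ev c1 j / ev c0 j).
Proof.
have [|c0 h0] := @row_functional_neq0 K _ (map p (enum 'I_M)).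
  by move=> _ /mapP[j _ ->].
have ev0 j : mmap idfun (p j 0) (linear_form c0) != 0.
  by rewrite mmap_linear_form h0 // map_f // mem_enum.
pose ev c j := mmap idfun (p j 0) (linear_form c).
pose w (ij : 'I_M * 'I_M) := ev c0 ij.2 *: p ij.1 - ev c0 ij.1 *: p ij.2.
have [|c1 h1] := @row_functional_neq0 K _
    (map w (filter (fun ij => ij.1 != ij.2) (enum {: 'I_M * 'I_M}))).
  move=> x /mapP[[i j]]; rewrite mem_filter /= => /andP[ij _] ->.
  apply: contraNneq ij => /eqP; rewrite subr_eq0 => /eqP E; apply/eqP/p_inj.
  rewrite -(scalerK (ev0 j) (p i)) [X in _ *: X]E scalerA; apply: scalemx_sub.
  exact: submx_refl.
exists c0, c1; split=> // i j /= E; apply/eqP; apply: contraT => ij.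
have := h1 (w (i, j)); rewrite map_f; last by rewrite mem_filter /= ij mem_enum.
move=> /(_ isT); rewrite -mmap_linear_form.
suff -> : mmap idfun (w (i, j) 0) (linear_form c1) = ev c0 j * ev c1 i - ev c0 i * ev c1 j.
  have Ei : ev c1 i = ev c1 j / ev c0 j * ev c0 i by rewrite -E divfK // ev0.
  rewrite [X in X != 0](_ : _ = 0) ?eqxx // Ei; field; exact: ev0.
rewrite /ev !(mmap_linear_form c1) !mulr_sumr -sumrB; apply: eq_bigr => k _.
by rewrite !mxE /=; ring.
Qed.

Section Independence.
Variables (c0 c1 : 'rV[K]_n.+1) (L : nat).
Local Notation h0 := (linear_form c0).
Local Notation h1 := (linear_form c1).
Local Notation ev c j := (mmap idfun (p j 0) (linear_form c)).
Hypothesis ev0 : forall j, ev c0 j != 0.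
Hypothesis ev_inj : injective (fun j => ev c1 j / ev c0 j).

Definition monomials m N : seq 'X_{1..m} := [seq s2m t | t : N.-tuple 'I_m <- enum (basis m N)].

Lemma mem_monomials m N (k : 'X_{1..m}) : (k \in monomials m N) = (mdeg k == N).
Proof. by rewrite -basis_cover. Qed.

(** [h0 ^ D] is an extra generator of the same degree [D] as the [F i], nonzero at all points. The
    last factor tells the points apart and is padded with [h0] to the constant degree [M.-1]. *)
Definition power_product (m : 'X_{1..n.+1}) (b : nat) : {mpoly K[n.+1]} :=
  \prod_(i < n) F i ^+ m (widen i) * (h0 ^+ D) ^+ m ord_max *
  (h1 ^+ b * h0 ^+ (M.-1 - b)).

Lemma dhomog_prodX (I : Type) (r : seq I) (f : I -> {mpoly K[n.+1]}) (e : I -> nat) :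
  (forall i, f i \is (e i).-homog) ->
  \prod_(i <- r) f i \is (\sum_(i <- r) e i).-homog.
Proof.
move=> H; elim: r => [|i r IH]; first by rewrite !big_nil dhomog1.
by rewrite !big_cons dhomogM.
Qed.

Lemma dhomog_power_product m b : mdeg m = L -> (b <= M.-1)%N ->
  power_product m b \is (D * L + M.-1).-homog.
Proof.
move=> mL bM.
have -> : (D * L + M.-1 = \sum_(i < n) D * m (widen i) + 1 * D * m ord_max +
   (1 * b + 1 * (M.-1 - b)))%N.
  rewrite !mul1n subnKC // -mL mdegE big_ord_recr /= mulnDr big_distrr /=.
  by [].
do 2![apply: dhomogM].
- by apply: dhomog_prodX => i; apply: dhomogMn.
- by do 2!apply: dhomogMn; apply: dhomog_linear_form.
- by apply: dhomogMn; apply: dhomog_linear_form.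
- by apply: dhomogMn; apply: dhomog_linear_form.
Qed.

(** The guaranteed order of vanishing of a product at each of the points. *)
Definition tail_deg (m : 'X_{1..n.+1}) : nat := (\sum_(i < n) m (widen i))%N.

Variable c : 'I_M * 'I_(size (monomials n.+1 L)) -> K.
Local Notation mono a := (nth 0%MM (monomials n.+1 L) (nat_of_ord a)).
Hypothesis relation : \sum_ba c ba *: power_product (mono ba.2) ba.1 = 0.

Lemma mdeg_mono (a : 'I_(size (monomials n.+1 L))) : mdeg (mono a) = L.
Proof. by apply/eqP; rewrite -mem_monomials mem_nth. Qed.

Lemma mono_max (a : 'I_(size (monomials n.+1 L))) : mono a ord_max = (L - tail_deg (mono a))%N.
Proof. by have := mdeg_mono a; rewrite mdegE big_ord_recr /= -/(tail_deg _); lia. Qed.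

(* The coefficient of order k of the relation along a line through p j: there F
   vanishes to first order, with an arbitrary direction y as its derivative. *)
Lemma tail_coef k j (y : 'rV[K]_n) :
  (forall b a, (tail_deg (mono a) < k)%N -> c (b, a) = 0) ->
  \sum_(a | tail_deg (mono a) == k)
    (\sum_b c (b, a) * (ev c1 j / ev c0 j) ^+ b) *
    \prod_i y 0 i ^+ mono a (widen i) = 0.
Proof.
move=> IH; have [v vJ] := jacobian_surj j y.
pose th := on_line (p j 0) (v 0).
have th0 f : (th f).[0] = mmap idfun (p j 0) f.
  by rewrite /th horner_on_line; apply: mmap_ext => i; rewrite mulr0 addr0.
have thF i : {g : {poly K} | th (F i) = g * 'X & g.[0] = y 0 i}.
  have /factor_theorem/sig_eqW[g gE] : root (th (F i)) 0 by rewrite rootE th0 Fp.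
  rewrite subr0 in gE; exists g => //.
  have := congr1 (fun q => q^`().[0]) gE.
  rewrite derivM derivX hornerD !hornerM hornerX hornerC mulr0 add0r mulr1 => <-.
  rewrite /th deriv_on_line horner_sum -vJ !mxE; apply: eq_bigr => q _.
  by rewrite hornerZ -/th th0 !mxE.
pose g i := s2val (thF i).
have gX i : th (F i) = g i * 'X by rewrite /g; case: (thF i).
have g0 i : (g i).[0] = y 0 i by rewrite /g; case: (thF i).
pose G (m : 'X_{1..n.+1}) b := \prod_i g i ^+ m (widen i) * (th h0 ^+ D) ^+ m ord_max *
  (th h1 ^+ b * th h0 ^+ (M.-1 - b)).
have thE m b : th (power_product m b) = 'X ^+ tail_deg m * G m b.
  rewrite /th /power_product /on_line !rmorphM rmorph_prod !rmorphXn /= -/(on_line _ _ _) -/th.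
  rewrite (eq_bigr (fun i => g i ^+ m (widen i) * 'X^(m (widen i)))); last first.
    by move=> i _; rewrite rmorphXn /= -/(on_line _ _ _) -/th -exprMn -gX.
  by rewrite big_split /= prodrXr /G -/(tail_deg _); ring.
(* The relation on the line divided by ['X ^+ k]; at 0 only the terms of tail degree exactly [k]
   survive. *)
pose S := \sum_(ba | (k <= tail_deg (mono ba.2))%N)
  c ba *: ('X ^+ (tail_deg (mono ba.2) - k) * G (mono ba.2) ba.1).
have S0 : S = 0.
  have := congr1 th relation.
  rewrite (_ : th 0 = 0); last by rewrite /th /on_line mmap0.
  rewrite (_ : th _ = 'X ^+ k * S).
    by move/eqP; rewrite mulf_eq0 expf_eq0 polyX_eq0 andbF => /eqP.
  rewrite /th /on_line raddf_sum /S mulr_sumr [RHS]big_mkcond /=.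
  apply: eq_bigr => -[b a] _ /=; rewrite mmapZ /= -/(on_line _ _ _) -/th thE.
  case: leqP => [ka|ka]; last by rewrite IH // polyC0 mul0r.
  by rewrite mul_polyC -scalerAr; congr (_ *: _); rewrite [RHS]mulrA -exprD subnKC.
pose e0 := ev c0 j; pose r := ev c1 j / e0.
have e00 : e0 != 0 by apply: ev0.
have G0 m b : (b <= M.-1)%N -> tail_deg m = k -> m ord_max = (L - k)%N ->
    (G m b).[0] = e0 ^+ (D * (L - k)) * e0 ^+ M.-1 * (r ^+ b * \prod_i y 0 i ^+ m (widen i)).
  move=> bM mk mL; rewrite /G !hornerM horner_prod mL -exprM !horner_exp !th0.
  rewrite (eq_bigr (fun i => y 0 i ^+ m (widen i))); last first.
    by move=> i _; rewrite horner_exp g0.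
  rewrite -/e0 -{2}(subnK bM) exprD /r expr_div_n; field.
  by rewrite expf_neq0.
apply: (mulfI (_ : e0 ^+ (D * (L - k)) * e0 ^+ M.-1 != 0)).
  by rewrite mulf_neq0 // expf_neq0.
have := congr1 (horner^~ 0) S0; rewrite /S horner0 horner_sum => SE.
rewrite mulr0 -[RHS]SE mulr_sumr big_mkcond /= [RHS]big_mkcond /=.
transitivity (\sum_b \sum_a if (k <= tail_deg (mono a))%N then
  (c (b, a) *: ('X ^+ (tail_deg (mono a) - k) * G (mono a) b)).[0] else 0); last first.
  by rewrite pair_bigA; apply: eq_bigr => -[].
rewrite exchange_big /=.
apply: eq_bigr => a _; have [ka|ka] := eqVneq (tail_deg (mono a)) k; last first.
  rewrite big1 // => b _; case: leqP => // ka'.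
  by rewrite hornerZ hornerM hornerXn expr0n subn_eq0 leqNgt ltn_neqAle eq_sym ka ka' mul0r mulr0.
rewrite ka leqnn mulr_suml mulr_sumr; apply: eq_bigr => b _.
rewrite subnn expr0 mul1r hornerZ G0 // ?mono_max ?ka //; first by rewrite /r /e0; ring.
by rewrite -ltnS prednK // (leq_ltn_trans _ (ltn_ord b)).
Qed.

(** Two separations: [y] is arbitrary, so the monomials in [y] split off each [a]; then the
    polynomial in the ratio with coefficients [c (b, a)] has degree below [M] and vanishes at [M]
    distinct ratios. *)
Lemma tail_coef_eq0 k : (forall b a, (tail_deg (mono a) < k)%N -> c (b, a) = 0) ->
  forall b a, tail_deg (mono a) = k -> c (b, a) = 0.
Proof.
move=> IH b a ka.
pose tl (m : 'X_{1..n.+1}) := [multinom m (widen i) | i < n].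
have H j : \sum_b c (b, a) * (ev c1 j / ev c0 j) ^+ b = 0.
  pose W : {mpoly K[n]} := \sum_(a | tail_deg (mono a) == k)
    (\sum_b c (b, a) * (ev c1 j / ev c0 j) ^+ b) *: 'X_[tl (mono a)].
  have W0 : W = 0.
    apply: mpoly_eq0_forall => y; rewrite /W raddf_sum /=.
    rewrite -[RHS](@tail_coef k j (\row_i y i)) //; apply: eq_bigr => a' _.
    rewrite mmapZ mmapX /mmap1; congr (_ * _); apply: eq_bigr => i _.
    by rewrite mxE /tl mnmE.
  have := congr1 (mcoeff (tl (mono a))) W0; rewrite mcoeff0 /W raddf_sum /=.
  rewrite (bigD1 a) ?ka ?eqxx //= mcoeffZ mcoeffX eqxx mulr1 [X in _ + X]big1 ?addr0.
    by [].
  move=> a' /andP[/eqP ka' aa']; rewrite mcoeffZ mcoeffX.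
  case: eqP => [E|]; last by rewrite mulr0.
  case/eqP: aa'; apply/val_inj/eqP; rewrite -(nth_uniq 0%MM (ltn_ord a') (ltn_ord a)) ?uniq_basis //.
  apply/eqP/mnmP => i; have [q ->|->] := unliftP ord_max i.
    by move/mnmP/(_ q): E; rewrite !mnmE widen_lift.
  by rewrite !mono_max ka ka'.
pose P : {poly K} := \poly_(b < M) (if insub b is Some b' then c (b', a) else 0).
have Pc b' : P`_(nat_of_ord b') = c (b', a).
  by rewrite coef_poly ltn_ord valK.
rewrite -Pc; suff -> : P = 0 by rewrite coef0.
apply/eqP; apply: contraT => P0.
have := @max_poly_roots _ P [seq ev c1 j / ev c0 j | j <- enum 'I_M] P0.
rewrite size_map size_enum_ord ltnNge size_poly; apply.
  apply/allP => _ /mapP[j _ ->]; rewrite rootE; apply/eqP.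
  rewrite -[RHS](H j) horner_poly; apply: eq_bigr => b' _.
  by rewrite valK.
by rewrite map_inj_uniq ?enum_uniq.
Qed.

Lemma relation_trivial ba : c ba = 0.
Proof.
case: ba => b a; suff H k : forall b a, (tail_deg (mono a) < k)%N -> c (b, a) = 0.
  by apply: (H (tail_deg (mono a)).+1).
elim: k => // k IH b' a'; rewrite ltnS leq_eqVlt => /orP[/eqP|]; last exact: IH.
exact: tail_coef_eq0.
Qed.

End Independence.

(** With more products than monomials of degree [D * L + M.-1] there would be a nontrivial relation.
    The surplus degree [M.-1] does not depend on [L] and is lost asymptotically. *)
Lemma nondegenerate_bezout : (M <= D ^ n)%N.
Proof.
have [c0 [c1 [ev0 ev_inj]]] := separating_forms.
apply: (@leq_bin_asymptotic _ _ _ M.-1) => L; rewrite leqNgt; apply/negP => lt.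
pose N := (D * L + M.-1)%N.
pose I : finType := ('I_M * 'I_(size (monomials n.+1 L)))%type.
pose J : finType := 'I_(size (monomials n.+1 N)).
pose pp (ba : I) := power_product c0 c1 (nth 0%MM (monomials n.+1 L) ba.2) ba.1.
have [|c [ba c0ba] rel] := @exists_linear_relation K I J
   (fun ba e => (pp ba)@_(nth 0%MM (monomials n.+1 N) e)).
- by rewrite card_prod !card_ord /monomials !size_basis.
have ppN ba' : pp ba' \is N.-homog.
  apply: dhomog_power_product; first by apply: mdeg_mono.
  by rewrite -ltnS prednK // (leq_ltn_trans _ (ltn_ord ba'.1)).
case/eqP: c0ba; apply: (relation_trivial ev0 ev_inj).
apply/mpolyP => m; rewrite mcoeff0.
have [mN|mN] := eqVneq (mdeg m) N; last first.
  have : \sum_ba c ba *: pp ba \is N.-homog by apply: rpred_sum => i _; rewrite rpredZ.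
  by move/dhomog_nemf_coeff => ->.
have mm : m \in monomials n.+1 N by rewrite mem_monomials mN.
have im : (index m (monomials n.+1 N) < size (monomials n.+1 N))%N by rewrite index_mem.
rewrite -[RHS](rel (Ordinal im)) raddf_sum; apply: eq_bigr => i _.
by rewrite /= mcoeffZ nth_index.
Qed.

End Bezout.

(** * The upper bound *)

Section EigenSystem.
Variables (R : realType) (n d : nat) (g : {mpoly R[n]}) (c : 'rV[R]_n) (e : R).
Hypothesis hom_g : g \is d.+3.-homog.
Local Notation widen := (widen_ord (leqnSn n)).
Local Notation ell := (linear_form c).

(** For [g] of degree [d.+3], these [d.+1] factors bring [q * x_i] to the degree [d.+2] of the
    partial derivatives. On [ell = 1] the roots [t = k] are real and distinct, and remain so after
    subtracting a small constant. *)
Definition scale_form : {mpoly R[n.+1]} :=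
  \prod_(k < d.+1) ('X_ord_max - k%:R *: mwiden ell).
Local Notation q := scale_form.

(* Its zeros are the eigenvectors x of e *: g together with the d.+1 roots t of
   q(x, t) = eigenvalue, and the point (0 : 1). *)
Definition eigen_system (i : 'I_n) : {mpoly R[n.+1]} :=
  e *: mwiden g^`M(i) - q * 'X_(widen i).
Local Notation F := eigen_system.

Lemma dhomog_scale_form : q \is d.+1.-homog.
Proof.
have := @dhomog_prodX R n 'I_d.+1 (index_enum _) (fun k => 'X_ord_max - k%:R *: mwiden ell)
  (fun=> 1%N); rewrite sum_nat_const card_ord muln1; apply => k.
by rewrite rpredB ?rpredZ ?dhomog_mwiden ?dhomog_linear_form // dhomogX /= mdeg1.
Qed.

Lemma dhomog_eigen_system i : F i \is d.+2.-homog.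
Proof.
rewrite rpredB ?rpredZ ?dhomog_mwiden ?dhomog_mderiv // -[d.+2]addn1.
by rewrite dhomogM ?dhomog_scale_form // dhomogX /= mdeg1.
Qed.

Lemma mmap_eigen_system y t i :
  mmap idfun (ext y t 0) (F i) =
  e * (grad idfun g y) 0 i - mmap idfun (ext y t 0) q * y 0 i.
Proof.
by rewrite mmapB mmapZ rmorphM /= mmap_mwiden_ext mmapX mmap1U ext_widen mxE.
Qed.

Definition dq y t (w : 'rV[R]_n) s : R :=
  \sum_k w 0 k * mmap idfun (ext y t 0) q^`M(widen k) +
  s * mmap idfun (ext y t 0) q^`M(ord_max).

Lemma jacobian_eigen_system M (p : 'I_M -> 'rV[R]_n.+1) j y t w s : p j = ext y t ->
  ext w s *m jacobian F p j =
  e *: (w *m hess g y) - dq y t w s *: y - mmap idfun (ext y t 0) q *: w.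
Proof.
move=> pj; apply/rowP => i; rewrite !mxE big_ord_recr /= ext_max !mxE pj.
set ev := mmap idfun (ext y t 0).
have evB a b : ev (a - b) = ev a - ev b by rewrite /ev mmapB.
have evD a b : ev (a + b) = ev a + ev b by rewrite /ev mmapD.
have evM a b : ev (a * b) = ev a * ev b by rewrite /ev rmorphM.
have evZ a b : ev (a *: b) = a * ev b by rewrite /ev mmapZ.
have evX : ev 'X_(widen i) = y 0 i by rewrite /ev mmapX mmap1U ext_widen.
have evN (b : bool) : ev b%:R = b%:R by rewrite /ev rmorph_nat.
rewrite mderivB mderivZ mderiv_mwiden_max scaler0 sub0r mderivM mderivXU.
rewrite -val_eqE /= gtn_eqF // mulr0 addr0 -[ev (- _)]opprK -mulN1r.
have -> : ev (- (q^`M(ord_max) * 'X_(widen i))) = - (ev q^`M(ord_max) * y 0 i).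
  by rewrite -sub0r evB evM evX /ev mmap0 sub0r.
have term k : ext w s 0 (widen k) * jacobian F p j (widen k) i =
    e * (w 0 k * hess g y k i) - (w 0 k * ev q^`M(widen k)) * y 0 i -
    ev q * ((i == k)%:R * w 0 k).
  rewrite ext_widen !mxE pj -/ev /F mderivB mderivZ mderiv_mwiden mderivM mderivXU.
  rewrite evB evD !evM evZ evX evN /ev mmap_mwiden_ext -/ev mderiv_comm.
  by rewrite -val_eqE /= val_eqE eq_sym; ring.
rewrite (eq_bigr _ (fun k _ => term k)) !sumrB -!mulr_sumr -mulr_suml.
have -> : \sum_k (i == k)%:R * w 0 k = w 0 i.
  rewrite (bigD1 i) //= eqxx mul1r big1 ?addr0 // => k ki.
  by rewrite eq_sym (negbTE ki) mul0r.
by rewrite /dq -/ev; ring.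
Qed.

Definition scale_poly : {poly R} := \prod_(k < d.+1) ('X - k%:R%:P).

Lemma slice_scale_form (y : 'rV[R]_n) : \sum_i c 0 i * y 0 i = 1 ->
  slice idfun y q = scale_poly.
Proof.
move=> y1; rewrite /slice /scale_form rmorph_prod; apply: eq_bigr => k _.
rewrite /= mmapB mmapZ mmapX mmap1U slice_max mmap_mwiden; congr (_ - _).
rewrite (mmap_ext _ (h := fun i => polyC (y 0 i))); last by move=> i; rewrite slice_widen.
suff -> : mmap (polyC \o idfun) (fun i => polyC (y 0 i)) ell = 1 by rewrite mulr1.
rewrite raddf_sum -[RHS]polyC1 -[in RHS]y1 rmorph_sum.
by apply: eq_bigr => i _; rewrite /= mmapZ mmapX mmap1U polyCM.
Qed.

Lemma mmap_scale_form (y : 'rV[R]_n) t : \sum_i c 0 i * y 0 i = 1 ->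
  mmap idfun (ext y t 0) q = scale_poly.[t].
Proof. by move=> y1; rewrite -(slice_scale_form y1) horner_slice. Qed.

Lemma mmap_scale_form_deriv (y : 'rV[R]_n) t : \sum_i c 0 i * y 0 i = 1 ->
  mmap idfun (ext y t 0) q^`M(ord_max) = scale_poly^`().[t].
Proof. by move=> y1; rewrite -(slice_scale_form y1) deriv_slice horner_slice. Qed.

Lemma scale_form_pole : mmap idfun (ext (0 : 'rV[R]_n) 1 0) q = 1.
Proof.
rewrite /scale_form rmorph_prod big1 // => k _.
rewrite /= mmapB mmapZ mmapX mmap1U ext_max mmap_mwiden_ext mmap_linear_form.
by rewrite big1 ?mulr0 ?subr0 // => i _; rewrite mxE mulr0.
Qed.

Lemma eigen_system_pole i : mmap idfun (ext (0 : 'rV[R]_n) 1 0) (F i) = 0.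
Proof.
have g0 : grad idfun g 0 = 0.
  by rewrite -{1}(scale0r 0) (gradZ _ _ _ hom_g) expr0n scale0r.
by rewrite mmap_eigen_system g0 mxE !mulr0 subr0.
Qed.

(** At the pole [q = 1], and the Hessian of [g] is 0 since its degree [d.+1] is positive; the
    Jacobian sends [(w, s)] to [- w]. *)
Lemma eigen_system_pole_regular M (p : 'I_M -> 'rV[R]_n.+1) j (v : 'rV[R]_n.+1) :
  p j = ext 0 1 -> v *m jacobian F p j = 0 -> (v <= p j)%MS.
Proof.
move=> pj; have [w [s ->]] : exists w s, v = ext w s by do 2!eexists; apply: ext_surj.
rewrite (jacobian_eigen_system w s pj) scale_form_pole scale1r scaler0 subr0.
have -> : hess g 0 = 0 by rewrite -{1}(scale0r 0) (hessZ _ _ hom_g) expr0n scale0r.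
rewrite mulmx0 scaler0 sub0r => /eqP; rewrite oppr_eq0 => /eqP ->.
by rewrite pj; apply/sub_rVP; exists s; rewrite extZ scaler0 mulr1.
Qed.

Section Point.
Variables (y : 'rV[R]_n) (l t : R).
Hypotheses (y1 : \sum_i c 0 i * y 0 i = 1) (gy : grad idfun g y = l *: y).
Hypothesis root_t : root (scale_poly + e *: (- l)%:P) t.

Lemma scale_poly_point : mmap idfun (ext y t 0) q = e * l.
Proof.
rewrite mmap_scale_form //; move: root_t.
rewrite rootE hornerD hornerZ hornerC => /eqP H; apply/eqP; rewrite -subr_eq0.
by apply/eqP; rewrite -[RHS]H; ring.
Qed.

Lemma eigen_system_point i : mmap idfun (ext y t 0) (F i) = 0.
Proof. by rewrite mmap_eigen_system gy scale_poly_point mxE; ring. Qed.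

(** Regularity of [g] makes [w] a multiple of [y], Euler's identity puts [(y, t)] in the kernel, and
    the Jacobian sends the remainder [(0, s')] to [- s' q_t y], which is nonzero for [s' != 0]
    because [t] is a simple root. *)
Lemma eigen_system_point_regular M (p : 'I_M -> 'rV[R]_n.+1) j (v : 'rV[R]_n.+1) :
  e != 0 -> regular g y -> (scale_poly + e *: (- l)%:P)^`().[t] != 0 ->
  p j = ext y t -> v *m jacobian F p j = 0 -> (v <= p j)%MS.
Proof.
move=> e0 ry simple pj.
have [w [s ->]] : exists w s, v = ext w s by do 2!eexists; apply: ext_surj.
move=> hv; have y0 : y != 0.
  apply/eqP => y0; move: y1; rewrite y0 big1 => [|i _]; last by rewrite mxE mulr0.
  by move/esym/eqP; rewrite oner_eq0.
have [a wE] : exists a, w = a *: y.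
  apply/sub_rVP; have := hv; rewrite (jacobian_eigen_system w s pj) scale_poly_point => E.
  apply: (ry l (dq y t w s / e) w gy); apply: (scalerI e0).
  rewrite scalerDr !scalerA [e * (_ / e)]mulrC divfK //.
  apply/eqP; rewrite -subr_eq0; apply/eqP; rewrite -[RHS]E.
  by rewrite opprD addrA addrAC.
have euler : ext y t *m jacobian F p j = 0.
  apply/rowP => i; rewrite !mxE -pj.
  transitivity (mmap idfun (p j 0) (F i *+ d.+2)); last first.
    by rewrite mmapMn pj eigen_system_point mul0rn.
  rewrite -(mpoly_euler (dhomog_eigen_system i)) raddf_sum; apply: eq_bigr => k _.
  by rewrite mxE /= rmorphM /= mmapX mmap1U.
have vE : ext w s = a *: ext y t + ext 0 (s - a * t).
  by rewrite extZ extD -wE addr0 addrC subrK.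
move: hv; rewrite vE mulmxDl -scalemxAl euler scaler0 add0r.
rewrite (jacobian_eigen_system _ _ pj) mul0mx !scaler0 sub0r subr0 => /eqP.
rewrite oppr_eq0 scaler_eq0 (negbTE y0) orbF /dq big1 => [|k _]; last by rewrite mxE mul0r.
rewrite add0r mmap_scale_form_deriv // mulf_eq0.
move: simple; rewrite derivD derivZ derivC scaler0 addr0 => /negbTE ->.
by rewrite orbF => /eqP ->; rewrite ext0 addr0 pj scalemx_sub.
Qed.

End Point.

End EigenSystem.

Section EigenBound.
Variables (R : realType) (n : nat).
Implicit Types (g : {mpoly R[n]}) (xs : seq 'rV[R]_n).

Lemma scale_poly_split d : simply_split (scale_poly R d) [seq k%:R | k <- iota 0 d.+1].
Proof.
split; first by rewrite map_inj_uniq ?iota_uniq // => a b /eqP; rewrite eqr_nat => /eqP.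
exists 1; first exact: oner_neq0.
rewrite scale1r big_map -[iota _ _]/(index_iota 0 d.+1) big_mkord; exact: eq_bigr.
Qed.

Lemma expected_number_pow d : (d.+1 * expected_number d.+3 n + 1 = d.+2 ^ n)%N.
Proof.
have := predn_exp d.+2 n; rewrite /= -/(expected_number d.+3 n) => <-.
by rewrite addn1 prednK // expn_gt0.
Qed.

Lemma eigen_bound_ge3 d g xs : g \is d.+3.-homog -> uniq xs ->
  {in xs &, forall x y, (x <= y)%MS -> x = y} ->
  {in xs, forall x, [/\ x != 0, exists l, grad idfun g x = l *: x & regular g x]} ->
  (size xs <= expected_number d.+3 n)%N.
Proof.
move=> hg us prop xsP.
have [|c hc] := @row_functional_neq0 R _ xs; first by move=> x /xsP[].
pose el (x : 'rV[R]_n) := \sum_i c 0 i * x 0 i.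
have elZ a x : el (a *: x) = a * el x.
  by rewrite /el mulr_sumr; apply: eq_bigr => i _; rewrite mxE mulrCA.
(* Representatives with [el = 1], on which the factors of [scale_form] become [t - k]. *)
pose nm x := (el x)^-1 *: x.
pose lam y := el (grad idfun g y).
have nm1 x : x \in xs -> el (nm x) = 1 by move=> /hc h; rewrite elZ mulVf.
have el0 x : x \in xs -> (el x)^-1 != 0 by move=> /hc; rewrite invr_eq0.
have gnm x : x \in xs -> grad idfun g (nm x) = lam (nm x) *: nm x.
  move=> xs1; have [_ [l gx] _] := xsP x xs1.
  have [l' E] := eigen_scale hg (el0 x xs1) gx.
  by rewrite /lam E elZ -/(nm x) nm1 // mulr1.
have rnm x : x \in xs -> regular g (nm x).
  by move=> xs1; have [_ _ rx] := xsP x xs1; apply: regularZ hg (el0 x xs1) rx.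
have sp := scale_poly_split d.
have ssp := size_simply_split sp; rewrite size_map size_iota in ssp.
have [e e0 He] : exists2 e, 0 < e & {in xs, forall x, exists2 r, size r = d.+1 &
    simply_split (scale_poly R d + e *: (- lam (nm x))%:P) r}.
  apply: eventually_small_ex; apply: eventually_small_all => x xs1.
  have := @simply_split_perturb _ _ (- lam (nm x))%:P _ sp.
  rewrite ssp size_map size_iota; apply => //.
  by rewrite (leq_trans (size_polyC_leq1 _)).
have en0 : e != 0 by rewrite gt_eqF.
have [x|rts rtsP] := @boolp.choice _ _ (fun (x : 'rV[R]_n) r => x \in xs ->
    size r = d.+1 /\ simply_split (scale_poly R d + e *: (- lam (nm x))%:P) r).
  case: (boolP (x \in xs)) => [/He [r r1 r2]|]; first by exists r.
  by exists [::].
pose s' := [seq ext (nm x) t | x <- xs, t <- rts x].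
pose ps := ext 0 1 :: s'.
have s'P z : z \in s' -> exists x t, [/\ x \in xs, t \in rts x & z = ext (nm x) t].
  by move/allpairsPdep => [x [t]]; exists x, t.
have nm0 x : x \in xs -> nm x != 0.
  move=> xs1; have [x0 _ _] := xsP x xs1.
  by rewrite scaler_eq0 negb_or x0 el0.
have nm_inj x y a : x \in xs -> y \in xs -> nm x = a *: nm y -> x = y /\ a = 1.
  move=> xs1 ys1 E; have a1 : a = 1 by rewrite -(nm1 x xs1) E elZ nm1 // mulr1.
  split=> //; apply: prop => //; rewrite -(scalerK (el0 x xs1) x) -/(nm x) E.
  by rewrite scalemx_sub // scalemx_sub // scalemx_sub.
have szps : size ps = (d.+1 * size xs + 1)%N.
  rewrite /ps /= size_allpairs_dep addn1; congr _.+1.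
  rewrite sumnE big_map big_seq (eq_bigr (fun=> d.+1)) => [|x /rtsP[]//].
  by rewrite -big_seq big_const_seq count_predT iter_addn_0.
have ups : uniq ps.
  rewrite cons_uniq; apply/andP; split.
    apply/negP => /s'P[x [t [xs1 _ /ext_inj[E _]]]].
    by have := nm0 _ xs1; rewrite -E eqxx.
  apply: allpairs_uniq_dep => //; first by move=> x /rtsP[_ []].
  move=> [x t] [x' t'] /allpairsPdep[? [? [xs1 _ [-> _]]]].
  move=> /allpairsPdep[? [? [xs2 _ [-> _]]]] /= /ext_inj[E ->].
  by have [|-> _] := nm_inj _ _ 1 xs1 xs2; rewrite ?scale1r.
have prop_ps : {in ps &, forall z z', (z <= z')%MS -> z = z'}.
  move=> z z'; rewrite !inE => /orP[/eqP->|/s'P[x [t [xs1 _ ->]]]].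
    case/orP=> [/eqP->//|/s'P[x [t [xs1 _ ->]]]] /sub_rVP[a].
    rewrite extZ => /ext_inj[/esym/eqP]; rewrite scaler_eq0 (negbTE (nm0 _ xs1)) orbF.
    by move=> /eqP -> /eqP; rewrite mul0r oner_eq0.
  case/orP=> [/eqP->|/s'P[x' [t' [xs2 _ ->]]]] /sub_rVP[a].
    by rewrite extZ scaler0 => /ext_inj[E]; have := nm0 _ xs1; rewrite E eqxx.
  rewrite extZ => /ext_inj[E ->]; have [-> ->] := nm_inj _ _ _ xs1 xs2 E.
  by rewrite mul1r.
pose p (j : 'I_(size ps)) := nth 0 ps j.
have pP j : p j = ext 0 1 \/ exists x t, [/\ x \in xs, t \in rts x & p j = ext (nm x) t].
  have : p j \in ps by apply: mem_nth.
  by rewrite inE => /orP[/eqP|/s'P]; [left|right].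
have hF := dhomog_eigen_system c e hg.
have : (size ps <= d.+2 ^ n)%N.
  apply: (@nondegenerate_bezout R n d.+2 (size ps) (eigen_system d g c e) p) => //.
  - move=> j i; have [->|[x [t [xs1 tx ->]]]] := pP j; first exact: eigen_system_pole.
    have [_ sq] := rtsP x xs1.
    by apply: (eigen_system_point (nm1 x xs1) (gnm x xs1)); rewrite (simply_split_mem _ sq).
  - move=> j v; have [pj|[x [t [xs1 tx pj]]]] := pP j.
      exact: eigen_system_pole_regular.
    have [_ sq] := rtsP x xs1.
    apply: (eigen_system_point_regular hg (nm1 x xs1) (gnm x xs1) _ en0 (rnm x xs1) _ pj).
      by rewrite (simply_split_mem _ sq).
    exact: simply_split_deriv sq tx.
  - move=> j; have [->|[x [t [xs1 _ ->]]]] := pP j.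
      by rewrite -ext0; apply/eqP => /ext_inj[_ /eqP]; rewrite oner_eq0.
    by rewrite -ext0; apply/eqP => /ext_inj[E]; have := nm0 _ xs1; rewrite E eqxx.
  - move=> i j /(prop_ps _ _ (mem_nth _ (ltn_ord i)) (mem_nth _ (ltn_ord j))) /eqP.
    by rewrite nth_uniq // => /eqP/val_inj.
by rewrite szps -expected_number_pow leq_add2r leq_pmul2l.
Qed.

(** The Hessian is a constant matrix. Regularity makes eigenvectors with equal eigenvalue parallel,
    so the eigenvalues are distinct roots of its characteristic polynomial. *)
Lemma eigen_bound2 g xs : g \is 2.-homog -> uniq xs ->
  {in xs &, forall x y, (x <= y)%MS -> x = y} ->
  {in xs, forall x, [/\ dot x x = 1, exists l, grad idfun g x = l *: x & regular g x]} ->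
  (size xs <= expected_number 2 n)%N.
Proof.
move=> hg us prop xsP.
have -> : expected_number 2 n = n.
  rewrite /expected_number (eq_bigr (fun=> 1%N)) ?sum1_card ?card_ord // => i _.
  by rewrite exp1n.
pose lam x := dot x (grad idfun g x).
have lamP x : x \in xs -> grad idfun g x = lam x *: x.
  move=> /xsP[x1 [l gx] _]; rewrite /lam gx -{2}(scale1r x) dotZ mul1r x1 mulr1 //.
have hessE x : hess g x = hess g 0.
  by rewrite -{1}(scale0r x) (hessZ _ _ hg) expr0 scale1r.
have eig x : x *m hess g 0 = grad idfun g x.
  by rewrite -(hessE x) (hess_euler _ hg) scale1r.
have ul : uniq (map lam xs).
  rewrite map_inj_in_uniq // => x y xs1 ys1 E; apply: esym; apply: prop => //.
  have [_ _ rx] := xsP x xs1.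
  apply: (rx (lam x) 0 y (lamP x xs1)).
  by rewrite hessE eig lamP // E scale0r addr0.
have := @max_poly_roots _ (char_poly (hess g 0)) (map lam xs).
rewrite size_map size_char_poly ltnS; apply => //.
  by rewrite monic_neq0 // char_poly_monic.
apply/allP => _ /mapP[x xs1 ->]; rewrite -eigenvalue_root_char.
apply/eigenvalueP; exists x; first by rewrite eig lamP.
by have [x1 _ _] := xsP x xs1; apply: unit_neq0 x1.
Qed.

(** The gradient is constant and the Hessian 0. Eigenvalue 0 would make every vector a multiple of
    [x], impossible for [n > 1]; so every [x] is parallel to the gradient. *)
Lemma eigen_bound1 g xs : (1 < n)%N -> g \is 1.-homog -> uniq xs ->
  {in xs &, forall x y, (x <= y)%MS -> x = y} ->
  {in xs, forall x, [/\ dot x x = 1, exists l, grad idfun g x = l *: x & regular g x]} ->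
  (size xs <= expected_number 1 n)%N.
Proof.
move=> n1 hg us prop xsP.
have -> : expected_number 1 n = 1%N.
  by case: (n) n1 => // k _; rewrite expected_numberS mul0n.
have gE x : grad idfun g x = grad idfun g 0.
  by rewrite -{1}(scale0r x) (gradZ _ _ _ hg) expr0 scale1r.
have h0 x : hess g x = 0.
  by apply/matrixP => i j; rewrite !mxE (mderiv_homog0 _ (dhomog_mderiv i hg)) mmap0.
have parallel x : x \in xs -> (x <= grad idfun g 0)%MS.
  move=> xs1; have [x1 [l gx] rx] := xsP x xs1.
  have l0 : l != 0.
    apply/eqP => l0; have H : (1%:M <= x)%MS.
      apply/row_subP => i; apply: (rx l 0 _ gx).
      by rewrite h0 mulmx0 l0 !scale0r addr0.
    by have := leq_trans (mxrankS H) (rank_leq_row x); rewrite mxrank1 leqNgt n1.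
  by rewrite -(gE x) gx; apply/sub_rVP; exists l^-1; rewrite scalerK.
case: xs us prop xsP parallel => [|x [|y s]] // us prop xsP par.
have xin : x \in [:: x, y & s] by rewrite mem_head.
have yin : y \in [:: x, y & s] by rewrite !inE eqxx orbT.
suff E : x = y by move: us; rewrite E /= mem_head.
apply: prop => //; apply: (submx_trans (par x xin)).
have [y1 [l gy] _] := xsP y yin.
by rewrite -(gE y) gy scalemx_sub.
Qed.

Lemma eigen_bound d g xs : (1 < n)%N -> (0 < d)%N -> g \is d.-homog -> uniq xs ->
  {in xs &, forall x y, (x <= y)%MS -> x = y} ->
  {in xs, forall x, [/\ dot x x = 1, exists l, grad idfun g x = l *: x & regular g x]} ->
  (size xs <= expected_number d n)%N.
Proof.
move=> n1; case: d => [|[|[|d]]] // _ hg us prop xsP.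
- exact: eigen_bound1 hg us prop xsP.
- exact: eigen_bound2 hg us prop xsP.
- apply: eigen_bound_ge3 hg us prop _ => x /xsP[x1 gx rx]; split=> //.
  exact: unit_neq0 x1.
Qed.

(** A functional vanishing at no point of [s] cuts it into two halves without antipodal pairs, so
    within each half distinct vectors give distinct eigenpoints. *)
Lemma sphere_critical_bound d g s : (1 < n)%N -> (0 < d)%N -> g \is d.-homog ->
  sphere_morse g -> uniq s -> {in s, forall x, sphere_critical g x} ->
  (size s <= 2 * expected_number d n)%N.
Proof.
case: d => // d n1 _ hg morse us sP.
have [|c hc] := @row_functional_neq0 R _ s.
  by move=> x /sP[x1 _]; apply: unit_neq0 x1.
pose el (x : 'rV[R]_n) := \sum_i c 0 i * x 0 i.
have elZ a x : el (a *: x) = a * el x.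
  by rewrite /el mulr_sumr; apply: eq_bigr => i _; rewrite mxE mulrCA.
have half (P : pred R) : (forall a b, P a -> P b -> 0 < a * b) ->
    (size [seq x <- s | P (el x)] <= expected_number d.+1 n)%N.
  move=> Ppos; apply: (eigen_bound n1 _ hg) => //; first exact: filter_uniq.
    move=> x y; rewrite !mem_filter => /andP[px xs] /andP[py ys] /sub_rVP[a xy].
    have [x1 _] := sP x xs; have [y1 _] := sP y ys.
    have : a ^+ 2 = 1 by rewrite -x1 xy dotZ y1 mulr1.
    move/eqP; rewrite sqrf_eq1 => /orP[/eqP a1|/eqP a1]; first by rewrite xy a1 scale1r.
    have := Ppos _ _ px py; rewrite xy a1 elZ mulN1r mulNr -expr2.
    by rewrite oppr_gt0 ltNge sqr_ge0.
  move=> x; rewrite mem_filter => /andP[_ xs].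
  have [x1 gx] := (sphere_criticalP g x).1 (sP x xs).
  by split=> //; apply: (sphere_morseP hg).1 morse x (sP x xs).
rewrite mul2n -addnn -(count_predC (fun x => 0 < el x) s) -!size_filter.
apply: leq_add; first by apply: (half (fun a => 0 < a)); apply: mulr_gt0.
rewrite (eq_in_filter (a2 := fun x => el x < 0)); last first.
  by move=> x xs /=; rewrite -leNgt lt_neqAle hc.
by apply: (half (fun a => a < 0)) => a b a0 b0; rewrite nmulr_rgt0.
Qed.

End EigenBound.

(** A duplicate-free list is extended as long as an element of [P] is missing, decided classically;
    [N] minus its length bounds the number of extensions. *)
Lemma number_of_bounded (T : eqType) (P : T -> Prop) N :
  (forall s : seq T, uniq s -> {in s, forall x, P x} -> (size s <= N)%N) ->
  exists2 k, (k <= N)%N & number_of P k.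
Proof.
move=> H; suff K m s : uniq s -> {in s, forall x, P x} -> (N - size s <= m)%N ->
    exists2 k, (k <= N)%N & number_of P k by apply: (K N [::]); rewrite ?subn0.
elim: m s => [|m IH] s us sP sm.
all: have [[x Px xs]|full] := boolp.pselect (exists2 x, P x & x \notin s); last first.
1,3: exists (size s); [exact: H|exists s; split=> // x; split=> [/sP//|Px]];
  by apply/negPn/negP => xs; apply: full; exists x.
all: have uxs : uniq (x :: s) by rewrite /= xs.
all: have xsP : {in x :: s, forall y, P y}
  by move=> y; rewrite inE => /orP[/eqP->//|/sP].
  by have := H _ uxs xsP; rewrite /=; lia.
by apply: (IH (x :: s)) => //=; lia.
Qed.

Theorem theorem1 (R : realType) (n d : nat) (hn : (2 <= n)%N) (hd : (1 <= d)%N) :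
  (exists A : tensor R n d,
     [/\ generic_symmetric A,
         forall p : {vspace 'rV[R[i]]_n},
           eigenpoint (complexify A) p -> real_point p
       & traceless A]) /\
  (exists f : {mpoly R[n]},
     [/\ f \is d.-homog,
         harmonic f,
         sphere_morse f
       & number_of (sphere_critical f) (2 * expected_number d n)]) /\
  (forall g : {mpoly R[n]}, g \is d.-homog -> sphere_morse g ->
     exists2 k : nat, (k <= 2 * expected_number d n)%N &
       number_of (sphere_critical g) k).
Proof.
have [f [s [hf harm sz conf]]] := maximal_configuration R (ltnW hn) hd.
case: d hd hf sz => // d _ hf sz.
have [number real] := real_configuration_eigenpoints hf conf.
have [morse crit] := real_configuration_sphere hf conf.
split; [|split].
- exists (tensor_of d.+1 f); split=> //; last exact: tensor_of_traceless.
  by split; [exact: tensor_of_symmetric|rewrite -sz].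
- by exists f; split; rewrite // -sz.
- move=> g hg gm; apply: number_of_bounded => t ut tP.
  exact: sphere_critical_bound gm ut tP.
Qed.
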